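(* Let $\mathfrak{n}^{\mathbb{Q}}$ be a graded rational Lie algebra, let $s\ge 2$, and consider the direct sum of $s$ copies $\tilde{\mathfrak{n}}^{\mathbb{Q}}=\mathfrak{n}^{\mathbb{Q}}\oplus\cdots\oplus\mathfrak{n}^{\mathbb{Q}}$. Then the real Lie algebra $\tilde{\mathfrak{n}}=\tilde{\mathfrak{n}}^{\mathbb{Q}}\otimes\mathbb{R}$ is Anosov. In other words, if $\mathfrak{n}$ is a graded real Lie algebra admitting a rational form, then $\tilde{\mathfrak{n}}=\mathfrak{n}\oplus\cdots\oplus\mathfrak{n}$ ($s$ times, $s\ge 2$) is Anosov.
   Context: All Lie algebras are finite-dimensional. A Lie algebra $\mathfrak{n}$ over a field $K$ is graded (over $\mathbb{N}$) if there are $K$-subspaces $\mathfrak{n}_i$ with $\mathfrak{n}=\mathfrak{n}_1\oplus\mathfrak{n}_2\oplus\cdots\oplus\mathfrak{n}_k$ and $[\mathfrak{n}_i,\mathfrak{n}_j]\subset\mathfrak{n}_{i+j}$ (with $\mathfrak{n}_l=0$ for $l>k$). A rational form of a real Lie algebra $\mathfrak{n}$ of dimension $n$ is an $n$-dimensional $\mathbb{Q}$-subspace $\mathfrak{n}^{\mathbb{Q}}\subset\mathfrak{n}$, closed under the Lie bracket, with $\mathfrak{n}^{\mathbb{Q}}\otimes\mathbb{R}=\mathfrak{n}$. A Lie algebra over $\mathbb{Q}$ of dimension $n$ is called Anosov if it admits a Lie algebra automorphism $A$ which is hyperbolic (every complex eigenvalue of $A$ has absolute value different from $1$) and unimodular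 (the matrix of $A$ with respect to some basis lies in $\mathrm{GL}_n(\mathbb{Z})$). A real Lie algebra is called Anosov if it admits a rational form which is Anosov; note that the Anosov rational form of $\tilde{\mathfrak{n}}$ need not be $\tilde{\mathfrak{n}}^{\mathbb{Q}}$. *)

(* Defs.v *)
From HB Require Import structures.
From mathcomp Require Import all_boot all_order all_algebra.
From mathcomp Require Import reals complex.

Set Implicit Arguments.
Unset Strict Implicit.
Unset Printing Implicit Defensive.

Import Order.TTheory GRing.Theory Num.Theory passmx.
Local Open Scope ring_scope.

HB.mixin Record Vector_isLieAlgebra (K : fieldType) L of Vector K L := {
  lie : L -> L -> L;
  lie_linearl : forall y, linear (lie^~ y);
  lie_linearr : forall x, linear (lie x);
  liexx : forall x, lie x x = 0;
  lie_jacobi : forall x y z,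
    lie x (lie y z) + lie y (lie z x) + lie z (lie x y) = 0
}.

#[short(type="lieAlgType")]
HB.structure Definition LieAlgebra (K : fieldType) :=
  { L of Vector_isLieAlgebra K L & Vector K L }.

Lemma lieDl (K : fieldType) (L : lieAlgType K) (x y z : L) :
  lie (x + y) z = lie x z + lie y z.
Proof. by have := lie_linearl z 1 x y; rewrite !scale1r. Qed.

Lemma lieDr (K : fieldType) (L : lieAlgType K) (x y z : L) :
  lie z (x + y) = lie z x + lie z y.
Proof. by have := lie_linearr z 1 x y; rewrite !scale1r. Qed.

Lemma lie0l (K : fieldType) (L : lieAlgType K) (y : L) : lie 0 y = 0.
Proof. by apply: (addrI (lie 0 y)); rewrite -lieDl !addr0. Qed.

Lemma lie0r (K : fieldType) (L : lieAlgType K) (y : L) : lie y 0 = 0.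
Proof. by apply: (addrI (lie y 0)); rewrite -lieDr !addr0. Qed.

Lemma lieZl (K : fieldType) (L : lieAlgType K) (a : K) (x y : L) :
  lie (a *: x) y = a *: lie x y.
Proof. by have := lie_linearl y a x 0; rewrite lie0l !addr0. Qed.

Lemma lieZr (K : fieldType) (L : lieAlgType K) (a : K) (x y : L) :
  lie y (a *: x) = a *: lie y x.
Proof. by have := lie_linearr y a x 0; rewrite lie0r !addr0. Qed.

(* The direct sum of copies of L indexed by I is {ffun I -> L}, with the      *)
(* componentwise bracket.                                                     *)
Definition ffun_lie (K : fieldType) (I : finType) (L : lieAlgType K)
  (f g : {ffun I -> L}) : {ffun I -> L} := [ffun i => lie (f i) (g i)].

Fact ffun_lie_linearl (K : fieldType) (I : finType) (L : lieAlgType K)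
  (g : {ffun I -> L}) : linear (@ffun_lie K I L ^~ g).
Proof. by move=> a f h; apply/ffunP => i; rewrite !ffunE lieDl lieZl. Qed.

Fact ffun_lie_linearr (K : fieldType) (I : finType) (L : lieAlgType K)
  (f : {ffun I -> L}) : linear (ffun_lie f).
Proof. by move=> a g h; apply/ffunP => i; rewrite !ffunE lieDr lieZr. Qed.

Fact ffun_liexx (K : fieldType) (I : finType) (L : lieAlgType K)
  (f : {ffun I -> L}) : ffun_lie f f = 0.
Proof. by apply/ffunP => i; rewrite !ffunE liexx. Qed.

Fact ffun_lie_jacobi (K : fieldType) (I : finType) (L : lieAlgType K)
  (f g h : {ffun I -> L}) :
  ffun_lie f (ffun_lie g h) + ffun_lie g (ffun_lie h f)
    + ffun_lie h (ffun_lie f g) = 0.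
Proof. by apply/ffunP => i; rewrite !ffunE lie_jacobi. Qed.

HB.instance Definition _ (K : fieldType) (I : finType) (L : lieAlgType K) :=
  Vector_isLieAlgebra.Build K {ffun I -> L} (@ffun_lie_linearl K I L)
    (@ffun_lie_linearr K I L) (@ffun_liexx K I L) (@ffun_lie_jacobi K I L).

(* L (x) R is modelled by coordinate rows with respect to the basis           *)
(* (b_i (x) 1)_i, where (b_i) is the basis vbasis fullv of L; real_ext_in is  *)
(* the embedding x |-> x (x) 1, and the bracket is its R-bilinear extension.  *)
Definition real_ext (R : realType) (L : lieAlgType rat) : Type :=
  'rV[R]_(\dim (fullv : {vspace L})).

HB.instance Definition _ (R : realType) (L : lieAlgType rat) :=
  Vector.copy (real_ext R L) 'rV[R]_(\dim (fullv : {vspace L})).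

Definition real_ext_in (R : realType) (L : lieAlgType rat) (x : L) :
  real_ext R L := map_mx ratr (rVof (vbasis fullv) x).

Definition real_ext_lie (R : realType) (L : lieAlgType rat)
    (v w : real_ext R L) : real_ext R L :=
  \sum_i \sum_j (v 0 i * w 0 j) *:
    real_ext_in R (lie (vbasis (fullv : {vspace L}))`_i (vbasis fullv)`_j).

Fact real_ext_lie_linearl (R : realType) (L : lieAlgType rat)
  (w : real_ext R L) : linear (@real_ext_lie R L ^~ w).
Proof.
move=> a u v; rewrite /real_ext_lie scaler_sumr -big_split; apply: eq_bigr => i _.
rewrite scaler_sumr -big_split; apply: eq_bigr => j _ /=.
by rewrite !mxE mulrDl scalerDl scalerA mulrA.
Qed.

Fact real_ext_lie_linearr (R : realType) (L : lieAlgType rat)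
  (w : real_ext R L) : linear (real_ext_lie w).
Proof.
move=> a u v; rewrite /real_ext_lie scaler_sumr -big_split; apply: eq_bigr => i _.
rewrite scaler_sumr -big_split; apply: eq_bigr => j _ /=.
by rewrite !mxE mulrDr scalerDl scalerA mulrCA.
Qed.

Fact real_ext_in_is_linear (R : realType) (L : lieAlgType rat) :
  linear_for (@ratr R \; *:%R) (@real_ext_in R L).
Proof.
move=> a x y; apply/rowP => i.
by rewrite !mxE linearP rmorphD rmorphM.
Qed.

HB.instance Definition _ (R : realType) (L : lieAlgType rat) :=
  GRing.isLinear.Build rat L (real_ext R L) (@ratr R \; *:%R)
    (@real_ext_in R L) (@real_ext_in_is_linear R L).

Lemma real_ext_in_basis (R : realType) (L : lieAlgType rat)
    (i : 'I_(\dim (fullv : {vspace L}))) :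
  real_ext_in R (vbasis fullv)`_i = delta_mx 0 i.
Proof.
apply/rowP => j.
by rewrite !mxE coord_free ?(basis_free (vbasisP _)) // eq_sym rmorph_nat eqxx.
Qed.

Lemma real_ext_lie_in (R : realType) (L : lieAlgType rat) (x y : L) :
  real_ext_lie (real_ext_in R x) (real_ext_in R y) = real_ext_in R (lie x y).
Proof.
rewrite {2}(coord_vbasis (memvf x)) {2}(coord_vbasis (memvf y)).
rewrite (big_morph (@lie _ L ^~ _) (fun u v => lieDl u v _) (lie0l _)) linear_sum.
apply: eq_bigr => i _.
rewrite (big_morph (@lie _ L _) (fun u v => lieDr u v _) (lie0r _)) linear_sum.
by apply: eq_bigr => j _; rewrite lieZl lieZr !linearZ /= scalerA !mxE.
Qed.

Fact real_ext_liexx (R : realType) (L : lieAlgType rat) (v : real_ext R L) :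
  real_ext_lie v v = 0.
Proof.
have lieC (x y : L) : lie y x = - lie x y.
  apply/eqP; rewrite -addr_eq0; apply/eqP; have := liexx (x + y).
  by rewrite lieDl !lieDr !liexx add0r addr0 addrC.
have eN : real_ext_lie v v = - real_ext_lie v v.
  rewrite {1}/real_ext_lie exchange_big -sumrN; apply: eq_bigr => i _.
  rewrite -sumrN; apply: eq_bigr => j _.
  by rewrite lieC linearN scalerN mulrC.
have /eqP := eN; rewrite -addr_eq0 -mulr2n -scaler_nat scaler_eq0.
by rewrite pnatr_eq0 /= => /eqP.
Qed.

Fact real_ext_lie_jacobi (R : realType) (L : lieAlgType rat)
  (u v w : real_ext R L) :
  real_ext_lie u (real_ext_lie v w) + real_ext_lie v (real_ext_lie w u)
    + real_ext_lie w (real_ext_lie u v) = 0.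
Proof.
pose E := real_ext R L; pose br := @real_ext_lie R L.
pose D (T : E -> E) := forall a x y, T (a *: x + y) = a *: T x + T y.
have Dbl z : D (br ^~ z) by exact: real_ext_lie_linearl.
have Dbr z : D (br z) by exact: real_ext_lie_linearr.
have ext (T : E -> E) : D T -> (forall x, T (real_ext_in R x) = 0) ->
    forall z, T z = 0.
  move=> DT T0 z.
  have T00 : T 0 = 0 by have := T0 0; rewrite linear0.
  rewrite [z]row_sum_delta; elim/big_rec: _ => // i y _ Ty.
  by rewrite DT Ty addr0 -real_ext_in_basis T0 scaler0.
have Dadd (S T : E -> E) : D S -> D T -> D (fun z => S z + T z).
  by move=> DS DT a x y; rewrite DS DT scalerDr addrACA.
have Dcomp (S T : E -> E) : D S -> D T -> D (fun z => S (T z)).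
  by move=> DS DT a x y; rewrite DT DS.
pose J x y z := br x (br y z) + br y (br z x) + br z (br x y).
have J1 y z : D (fun x => J x y z).
  by apply: (Dadd _ _); [apply: (Dadd _ _); [exact: (Dbl _) | exact: (Dcomp (br y) (br z))]
                  | exact: (Dcomp (br z) (br ^~ y))].
have J2 x z : D (fun y => J x y z).
  by apply: (Dadd _ _); [apply: (Dadd _ _); [exact: (Dcomp (br x) (br ^~ z)) | exact: (Dbl _)]
                  | exact: (Dcomp (br z) (br x))].
have J3 x y : D (J x y).
  by apply: (Dadd _ _); [apply: (Dadd _ _); [exact: (Dcomp (br x) (br y))
                                | exact: (Dcomp (br y) (br ^~ x))]
                  | exact: (Dbl _)].
apply: (ext _ (J1 v w)) => x; apply: (ext _ (J2 _ w)) => y.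
apply: (ext _ (J3 _ _)) => z.
by rewrite /J /br !real_ext_lie_in -!linearD lie_jacobi linear0.
Qed.

HB.instance Definition _ (R : realType) (L : lieAlgType rat) :=
  Vector_isLieAlgebra.Build R (real_ext R L) (@real_ext_lie_linearl R L)
    (@real_ext_lie_linearr R L) (@real_ext_liexx R L)
    (@real_ext_lie_jacobi R L).

(* V 0 is unconstrained and plays no role.                                    *)
Definition graded (K : fieldType) (L : lieAlgType K) : Prop :=
  exists (k : nat) (V : nat -> {vspace L}),
    [/\ (\sum_(i < k) V i.+1)%VS = fullv,
        directv (\sum_(i < k) V i.+1),
        forall l, (k < l)%N -> V l = 0%VS
      & forall i j x y, (0 < i)%N -> (0 < j)%N ->
          x \in V i -> y \in V j -> lie x y \in V (i + j)%N].

(* A rational form is given by a rational Lie algebra L together with a       *)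
(* Q-linear embedding iota of L in N that preserves brackets and maps a       *)
(* Q-basis of L to an R-basis of N, so that iota(L) (x) R = N: the rational   *)
(* subspace of N is iota(L). The subspace cannot be a {vspace _} because N    *)
(* is not finite-dimensional over Q.                                          *)
Definition rational_form (R : realType) (L : lieAlgType rat)
    (N : lieAlgType R) : Prop :=
  exists iota : {linear L -> N | @ratr R \; *:%R},
    (forall x y, iota (lie x y) = lie (iota x) (iota y)) /\
    basis_of fullv [seq iota b | b <- vbasis (fullv : {vspace L})].

Lemma real_ext_rational_form (R : realType) (L : lieAlgType rat) :
  rational_form L (real_ext R L).
Proof.
exists (@real_ext_in R L : {linear L -> real_ext R L | @ratr R \; *:%R}).
split=> [x y|]; first by rewrite /= -real_ext_lie_in.
have dimE : \dim (fullv : {vspace real_ext R L}) = \dim (fullv : {vspace L}).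
  by rewrite [LHS]dimvf -[RHS]mul1n.
rewrite basisEdim size_map size_tuple dimE leqnn andbT.
apply/subvP => v _; rewrite [v]row_sum_delta rpred_sum // => i _.
apply/rpredZ/memv_span; rewrite -real_ext_in_basis.
by apply/map_f/mem_nth; rewrite size_tuple.
Qed.

Definition lie_automorphism (K : fieldType) (L : lieAlgType K)
    (A : 'End(L)) : Prop :=
  bijective A /\ forall x y, A (lie x y) = lie (A x) (A y).

(* Complex numbers are R[i]. The eigenvalues do not depend on the basis used  *)
(* to represent A.                                                            *)
Definition hyperbolic (R : realType) (V : vectType rat) (A : 'End(V)) : Prop :=
  forall z : R[i],
    eigenvalue (map_mx ratr (mxof (vbasis fullv) (vbasis fullv) A)) z ->
    `|z| != 1.

Definition unimodular (V : vectType rat) (A : 'End(V)) : Prop :=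
  exists (e : (\dim (fullv : {vspace V})).-tuple V)
         (M : 'M[int]_(\dim (fullv : {vspace V}))),
    [/\ basis_of fullv e, M \in unitmx & mxof e e A = map_mx intr M].

Definition rational_anosov (R : realType) (L : lieAlgType rat) : Prop :=
  exists A : 'End(L), [/\ lie_automorphism A, hyperbolic R A & unimodular A].

Definition anosov (R : realType) (N : lieAlgType R) : Prop :=
  exists2 L : lieAlgType rat, rational_form L N & rational_anosov R L.

(* Main.v *)
(** Rational form and automorphism. Let p = prod_(j < s) (X - 3 j) - 1. It has
s distinct real roots th_k, none of absolute value 1, and p(0) = -1, so its
companion matrix C is unimodular. If L has a basis b_l of weights w_l for a
positive grading over the rationals, then L (x) Q[X]/(p) is a rational form of
the sum of s copies of L (x) R, by evaluation at the th_k, and multiplying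
b_l (x) Q[X]/(p) by X^(w_l) is an automorphism. Its matrix is made of the blocks
C^(w_l), and its eigenvalues are the th_k^(w_l).

Descent. If only L (x) R is known to be positively graded, the grading must first
be moved to L. The grading is a real derivation D0, diagonalizable with
positive eigenvalues. Derivations are the kernel of a rational matrix, so a
rational derivation D lies as close to D0 as wanted, and then D has positive
trace on each nonzero invariant subspace. Replace every eigenvalue of D by the
mean of its conjugates: this gives E = e(D) for a rational polynomial e such that,
for every operator A of a suitable family, e(A) is diagonalizable over Q and has
the trace of A. For commuting A and B the difference e(A + B) - e(A) - e(B) is
diagonalizable and has trace 0 on each of its eigenspaces, so it vanishes. With
A and B the two operators X |-> D^T X and X |-> X D on L (x) L, this says that E
is again a derivation. Its eigenvalues are rational, and they are positive since
the traces of E and D agree on the eigenspaces of E. *)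

From HB Require Import structures.
Require Import Defs.
From mathcomp Require Import all_boot all_order all_algebra.
From mathcomp Require Import reals complex.
From mathcomp Require Import all_field ring lra.

Set Implicit Arguments.
Unset Strict Implicit.
Unset Printing Implicit Defensive.

Import Order.TTheory GRing.Theory Num.Theory passmx.
Local Open Scope ring_scope.

(** * Averaging the conjugates of the eigenvalues *)

Lemma trig_mulmx (K : comNzRingType) (n : nat) (A B : 'M[K]_n) :
  is_trig_mx A -> is_trig_mx B ->
  is_trig_mx (A *m B) /\ forall i, (A *m B) i i = A i i * B i i.
Proof.
move=> /is_trig_mxP tA /is_trig_mxP tB; split=> [|i].
  apply/is_trig_mxP => i j lt_ij; rewrite mxE big1 // => k _.
  by have [/tA->|le_ki] := ltnP i k;
    rewrite ?mul0r // tB ?mulr0 // (leq_ltn_trans le_ki).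
rewrite mxE (bigD1 i) //= big1 ?addr0 // => k ne_ki.
have [/tA->|le_ki] := ltnP i k; rewrite ?mul0r // tB ?mulr0 //.
by rewrite ltn_neqAle le_ki andbT.
Qed.

Lemma trig_horner_mx (K : comNzRingType) (n : nat) (A : 'M[K]_n.+1)
    (p : {poly K}) :
  is_trig_mx A ->
  is_trig_mx (horner_mx A p) /\ forall i, horner_mx A p i i = p.[A i i].
Proof.
move=> tA; elim/poly_ind: p => [|p c [tp Ep]].
  by rewrite rmorph0; split=> [|i]; rewrite ?mx0_is_trig // mxE horner0.
rewrite rmorphD rmorphM /= horner_mx_X horner_mx_C.
have [tpA EpA] := trig_mulmx tp tA; split=> [|i].
  apply/is_trig_mxP => i j lt_ij; rewrite mxE (is_trig_mxP tpA) //.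
  by rewrite mxE -val_eqE ltn_eqF // addr0.
by rewrite mxE EpA Ep !mxE eqxx !hornerE.
Qed.

Lemma char_poly_conj (K : fieldType) (n : nat) (P A : 'M[K]_n) :
  P \in unitmx -> char_poly (P *m A *m invmx P) = char_poly A.
Proof.
move=> Pu; rewrite /char_poly /char_poly_mx.
have PuX : map_mx polyC P *m map_mx polyC (invmx P) = 1%:M.
  by rewrite -map_mxM mulmxV // map_mx1.
rewrite (_ : 'X%:M - _ =
  map_mx polyC P *m ('X%:M - map_mx polyC A) *m map_mx polyC (invmx P)).
  rewrite !det_mulmx mulrAC mulrC -det_mulmx PuX det1 mulr1 //.
rewrite mulmxBr mulmxBl -!map_mxM; congr (_ - _).
by rewrite scalar_mxC -mulmxA PuX mulmx1.
Qed.

Lemma horner_mx_roots (C : numClosedFieldType) (n : nat) (A : 'M[C]_n.+1) :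
  exists r : seq C, char_poly A = \prod_(x <- r) ('X - x%:P) /\
    forall p, \tr (horner_mx A p) = \sum_(x <- r) p.[x].
Proof.
have [P /unitarymx_unit Pu] := Schur A isT.
rewrite /similar_to conjumx //; set T := _ *m _ => tT.
have {}tT : is_trig_mx T by exact: tT.
exists [seq T i i | i : 'I_n.+1]; split=> [|p].
  by rewrite -(char_poly_conj A Pu) char_poly_trig // big_map big_enum.
rewrite big_map big_enum /=.
have <- : \tr (horner_mx T p) = \tr (horner_mx A p).
  by rewrite horner_mx_uconj // mxtrace_mulC mulmxA mulVmx ?mul1mx.
by apply: eq_bigr => i _; have [_ ->] := trig_horner_mx p tT.
Qed.

(* The mean of the roots of a monic polynomial, by Vieta. *)
Definition mean_root (p : {poly rat}) : rat :=
  - p`_(size p).-2 / (size p).-1%:R.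

Definition min_ratpoly (x : algC) (p : {poly rat}) : Prop :=
  p \is monic /\ forall q, root (map_poly ratr q) x = (p %| q).

Lemma min_ratpoly_exists (x : algC) : exists p, min_ratpoly x p.
Proof. by have [p [_ mp] px] := minCpolyP x; exists p. Qed.

Lemma min_ratpoly_root (x : algC) (p : {poly rat}) :
  min_ratpoly x p -> root (map_poly ratr p) x.
Proof. by case=> _ ->. Qed.

Lemma min_ratpoly_size (x : algC) (p : {poly rat}) :
  min_ratpoly x p -> (1 < size p)%N.
Proof.
move=> px; have [mp _] := px; rewrite -(size_map_poly (@ratr algC)).
by apply: root_size_gt1 (min_ratpoly_root px); rewrite map_poly_eq0 monic_neq0.
Qed.

Lemma min_ratpoly_dvd (x y : algC) (p q : {poly rat}) :
  min_ratpoly x p -> min_ratpoly y q -> q %| p -> q = p.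
Proof.
move=> px qy; have [[mp hp] [mq _]] := (px, qy) => /dvdpP[h Ep].
have h0 : h != 0 by apply: contraTneq (monic_neq0 mp) => h0;
  rewrite Ep h0 mul0r eqxx.
have ltq : (size h < size p)%N.
  rewrite Ep size_mul ?h0 ?(monic_neq0 mq) //; have := min_ratpoly_size qy.
  by case: (size q) => [|[|k]] // _; rewrite !addnS /= ltnS leq_addr.
apply/eqP; rewrite -eqp_monic // /eqp {1}Ep dvdp_mulIr /= -hp.
have := min_ratpoly_root px; rewrite {1}Ep rmorphM rootM => /orP[|//].
by rewrite (hp h) => /(dvdp_leq h0); rewrite leqNgt ltq.
Qed.

Lemma dvdp_prod_subC (K : fieldType) (d e e' : {poly K}) (s : seq K) :
  d %| e - e' ->
  (d %| \prod_(t <- s) (e - t%:P)) = (d %| \prod_(t <- s) (e' - t%:P)).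
Proof.
move=> de; rewrite -[X in d %| X](subrK (\prod_(t <- s) (e' - t%:P))).
rewrite dvdp_addr //; elim: s => [|t s IHs]; first by rewrite !big_nil subrr dvdp0.
rewrite !big_cons; set P := \prod_(_ <- s) (e - _); set P' := \prod_(_ <- s) _.
have -> : (e - t%:P) * P - (e' - t%:P) * P'
  = (e - e') * P + (e' - t%:P) * (P - P') by ring.
by apply: dvdp_add; [apply: dvdp_mulr | apply: dvdp_mull].
Qed.

Lemma exists_averaging_poly (chi : {poly rat}) : chi != 0 ->
  exists e : {poly rat},
    (exists2 s : seq rat, uniq s & chi %| \prod_(t <- s) (e - t%:P)) /\
    (forall (x : algC) (p : {poly rat}), min_ratpoly x p -> p %| chi ->
      p %| e - (mean_root p)%:P).
Proof.
have [m] := ubnP (size chi); elim: m => // m IHm in chi *.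
rewrite ltnS => le_chi chi0.
have [chi1|] := eqVneq (size chi) 1.
  exists 0; split; first by exists [::]; rewrite // big_nil dvdp1 chi1.
  move=> x p /min_ratpoly_size p1 /(dvdp_leq chi0).
  by rewrite chi1 leqNgt p1.
rewrite -(size_map_poly (@ratr algC)) => /closed_rootP[x chix].
have [p px] := min_ratpoly_exists x; have [mp hp] := px.
have p_chi : p %| chi by rewrite -hp.
pose psi := gdcop p chi; pose N := size chi.
have psi_chi : psi %| chi by exact: dvdp_gdco.
have cop : coprimep psi p by apply: coprimep_gdco.
have psi0 : psi != 0 by apply: contraNneq chi0 => E; rewrite E dvd0p in psi_chi.
have chi_psi : chi %| psi * p ^+ N by apply/dvdp_gdcor/monic_neq0.
have lt_psi : (size psi < size chi)%N.
  rewrite ltn_neqAle dvdp_leq // andbT; apply: contraTneq p_chi => /eqP.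
  rewrite (dvdp_size_eqp psi_chi) => /eqp_dvdr <-.
  apply: contraTN cop => p_psi; rewrite coprimep_sym /coprimep.
  rewrite (eqp_size (dvdp_gcd_idl p_psi)).
  by rewrite gtn_eqF // (min_ratpoly_size px).
have [e' [[s' us' dv'] he']] := IHm psi (leq_trans lt_psi le_chi) psi0.
have copN : coprimep psi (p ^+ N) by apply: coprimep_expr.
have /Bezout_eq1_coprimepP[[u v] /= uv] := copN.
pose t := mean_root p; pose e := e' * (v * p ^+ N) + t%:P * (u * psi).
have e_e' : psi %| e - e'.
  have -> : e - e' = (t%:P - e') * u * psi.
    rewrite -[X in _ - X = _]mulr1 -uv /e; ring.
  exact: dvdp_mulIr.
have e_t : p ^+ N %| e - t%:P.
  have -> : e - t%:P = (e' - t%:P) * v * p ^+ N.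
    rewrite -[X in _ - X = _]mulr1 -uv /e; ring.
  exact: dvdp_mulIr.
exists e; split.
  exists (undup (t :: s')); first exact: undup_uniq.
  apply: (dvdp_trans chi_psi); rewrite Gauss_dvdp //; apply/andP; split.
    rewrite (dvdp_prod_subC _ e_e') /=; case: ifP => _; rewrite undup_id //.
    by rewrite big_cons dvdp_mull.
  by rewrite (big_rem t) ?mem_undup ?mem_head // dvdp_mulr.
move=> y q qy q_chi; have [mq hq] := qy.
have : q %| psi * p ^+ N by apply: dvdp_trans q_chi chi_psi.
rewrite -hq rmorphM rootM rmorphXn /= => /orP[|qpN].
  rewrite hq => q_psi; rewrite -(subrK e' e) -addrA dvdp_add ?he' //.
    exact: dvdp_trans q_psi e_e'.
  by exact: he' qy q_psi.
have {qpN} : root (map_poly ratr p) y.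
  by move: qpN; rewrite /root horner_exp expf_eq0 => /andP[].
rewrite hq => /(min_ratpoly_dvd px qy) ->; apply: dvdp_trans e_t.
by apply: dvdp_exp (dvdpp p); rewrite size_poly_gt0.
Qed.

Lemma sum_averaging_poly (chi e : {poly rat}) :
  (forall (x : algC) (p : {poly rat}), min_ratpoly x p -> p %| chi ->
     p %| e - (mean_root p)%:P) ->
  forall (g : {poly rat}) (r : seq algC),
    map_poly ratr g = \prod_(x <- r) ('X - x%:P) ->
    (forall x, x \in r -> root (map_poly ratr chi) x) ->
    \sum_(x <- r) (map_poly ratr e).[x] = \sum_(x <- r) x.
Proof.
move=> he g r; have [m] := ubnP (size r); elim: m => // m IHm in g r *.
case: r => [|x r]; first by rewrite !big_nil.
set r0 := x :: r => le_r gE chi_r.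
have [p px] := min_ratpoly_exists x; have [mp hp] := px.
have mg : g \is monic by rewrite -(map_monic (@ratr algC)) gE monic_prod_XsubC.
have p_chi : p %| chi by rewrite -hp chi_r // mem_head.
have : p %| g by rewrite -hp gE root_prod_XsubC mem_head.
case/dvdpP=> h gh.
have mh : h \is monic by rewrite -(monicMr _ mp) -gh.
have prodE (q : {poly rat}) : q \is monic ->
    exists s : seq algC, map_poly ratr q = \prod_(y <- s) ('X - y%:P).
  move=> mq; have [s] := closed_field_poly_normal (map_poly (@ratr algC) q).
  by rewrite (monicP _) ?map_monic // scale1r; exists s.
have [[s1 E1] [s2 E2]] := (prodE p mp, prodE h mh).
have pr : perm_eq r0 (s1 ++ s2).
  by apply: prod_XsubC_eq; rewrite big_cat /= -E1 -E2 -rmorphM /= mulrC -gh.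
have size_p : size p = (size s1).+1.
  by rewrite -(size_map_poly (@ratr algC)) E1 size_prod_XsubC.
have s1_gt0 : (0 < size s1)%N by rewrite -ltnS -size_p (min_ratpoly_size px).
rewrite !(perm_big _ pr) !big_cat /=; congr (_ + _); last first.
  apply: IHm E2 _ => [|y ys2].
    apply: (@leq_trans (size r0)); last by rewrite -ltnS.
    by rewrite (perm_size pr) size_cat -{1}[size s2]add0n ltn_add2r.
  by apply: chi_r; rewrite (perm_mem pr) mem_cat ys2 orbT.
have eE y : y \in s1 -> (map_poly ratr e).[y] = ratr (mean_root p).
  move=> ys1; have : root (map_poly ratr p) y by rewrite E1 root_prod_XsubC.
  have /dvdpP[k /(canRL (subrK _)) ->] := he x p px p_chi.
  rewrite rmorphD rmorphM /= map_polyC /= hornerD hornerC hornerM => /eqP->.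
  by rewrite mulr0 add0r.
rewrite (eq_big_seq (fun=> ratr (mean_root p))) => [|y /eE //].
rewrite big_const_seq count_predT iter_addr_0 /mean_root size_p /=.
apply: oppr_inj; rewrite -coefPn_prod_XsubC -?lt0n // -E1 coef_map /=.
rewrite mulNr rmorphN rmorphM /= fmorphV /= ratr_nat mulNrn opprK.
by rewrite -mulrnAr -[_ *+ _]mulr_natl mulfV ?mulr1 // pnatr_eq0 -lt0n.
Qed.

Definition averaging (chi e : {poly rat}) : Prop :=
  forall (n : nat) (A : 'M[rat]_n.+1), horner_mx A chi = 0 ->
    diagonalizable (horner_mx A e) /\ \tr (horner_mx A e) = \tr A.

Lemma averaging_poly (chi : {poly rat}) : chi != 0 ->
  exists e : {poly rat}, averaging chi e.
Proof.
move=> chi0; have [e [[s us chi_s] he]] := exists_averaging_poly chi0.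
exists e => n A chiA; split.
  apply/diagonalizableP; exists s => //; apply/mxminpoly_minP.
  have /dvdpP[k Ek] := chi_s.
  have : horner_mx A (\prod_(t <- s) (e - t%:P)) = 0.
    by rewrite Ek rmorphM /= chiA mulr0.
  rewrite !rmorph_prod => <-; apply: eq_bigr => t _.
  by rewrite !rmorphB /= !horner_mx_C horner_mx_X.
pose AC := map_mx (@ratr algC) A.
have [r [charA trA]] := horner_mx_roots AC.
have trE (p : {poly rat}) :
    ratr (\tr (horner_mx A p)) = \sum_(x <- r) (map_poly ratr p).[x].
  by rewrite -trA -map_horner_mx /mxtrace rmorph_sum; apply: eq_bigr => i _;
    rewrite mxE.
apply: (fmorph_inj (@ratr algC)).
rewrite /= -[A in RHS]horner_mx_X !trE map_polyX.
rewrite (eq_bigr id (fun x _ => hornerX x)).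
apply: (sum_averaging_poly he (g := char_poly A)).
  by rewrite map_char_poly charA.
move=> x xr; have : root (char_poly AC) x by rewrite charA root_prod_XsubC.
rewrite -root_mxminpoly ; apply: root_dvdp.
apply/mxminpoly_min; rewrite -map_horner_mx chiA; exact: map_mx0.
Qed.

Lemma horner_mx_intertwine (K : fieldType) (m n : nat) (X : 'M[K]_(m.+1, n.+1))
    (A : 'M[K]_n.+1) (B : 'M[K]_m.+1) (p : {poly K}) :
  X *m A = B *m X -> X *m horner_mx A p = horner_mx B p *m X.
Proof.
move=> XA; elim/poly_ind: p => [|p c IHp]; first by rewrite !rmorph0 mul0mx mulmx0.
rewrite !rmorphD !rmorphM /= !horner_mx_X !horner_mx_C mulmxDl mulmxDr.
by rewrite mulmxA IHp -!mulmxA XA scalar_mxC.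
Qed.

Lemma row_free_base (K : fieldType) (m n : nat) (V : 'M[K]_(m, n)) : V != 0 ->
  exists k, exists2 B : 'M[K]_(k.+1, n), row_free B & (B :=: V)%MS.
Proof.
rewrite -mxrank_eq0; move: (row_base_free V) (eq_row_base V).
by move: (row_base V); case: (\rank V) => [|k] // B fB eB _; exists k, B.
Qed.

Lemma stable_base (K : fieldType) (m n k : nat) (V : 'M[K]_(m, n))
    (B : 'M[K]_(k, n)) (A : 'M[K]_n) :
  (B :=: V)%MS -> stablemx V A -> exists A', B *m A = A' *m B.
Proof.
move=> eB sV; exists (B *m A *m pinvmx B).
by rewrite mulmxKpV // (eqmxMr A eB) eB.
Qed.

Lemma averaging_trace (chi e : {poly rat}) (n k : nat) (A : 'M[rat]_n.+1)
    (B : 'M[rat]_(k.+1, n.+1)) (A' : 'M[rat]_k.+1) :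
  averaging chi e -> horner_mx A chi = 0 -> row_free B -> B *m A = A' *m B ->
  \tr (horner_mx A' e) = \tr A'.
Proof.
move=> av chiA fB BA; apply: (av _ _ _).2; apply: (row_free_inj fB).
by rewrite -(horner_mx_intertwine _ BA) chiA mulmx0 mul0mx.
Qed.

(* The three averages commute and are diagonalizable, hence so is their      *)
(* defect of additivity T; on each of its eigenspaces T has the trace of     *)
(* A + B minus those of A and B, which is zero.                              *)
Lemma averagingD (chi e : {poly rat}) (n : nat) (A B : 'M[rat]_n.+1) :
  averaging chi e -> comm_mx A B -> horner_mx A chi = 0 ->
  horner_mx B chi = 0 -> horner_mx (A + B) chi = 0 ->
  horner_mx (A + B) e = horner_mx A e + horner_mx B e.
Proof.
move=> av cAB chiA chiB chiC; have [[dA _] [dB _]] := (av _ _ chiA, av _ _ chiB).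
have [dC _] := av _ _ chiC.
pose T := horner_mx (A + B) e - (horner_mx A e + horner_mx B e).
have cC X : comm_mx X A -> comm_mx X B -> comm_mx X (A + B).
  by move=> cA cB; apply: comm_mxD.
have cAC : comm_mx A (A + B) by apply: cC.
have cBC : comm_mx B (A + B) by apply: cC => //; apply: comm_mx_sym.
have cTX X : comm_mx X A -> comm_mx X B -> comm_mx T X.
  move=> cA cB; apply: comm_mx_sym; rewrite /T.
  apply: comm_mxB; first by apply/comm_mx_horner/cC.
  by apply: comm_mxD; apply: comm_mx_horner.
suff T0 : T = 0 by apply/eqP; rewrite -subr_eq0 -/T T0.
have [P Pu] : codiagonalizable [:: horner_mx (A + B) e; horner_mx A e;
  horner_mx B e].
  apply/codiagonalizableP; split=> [X Y|X]; rewrite !inE; last first.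
    by case/or3P=> /eqP->.
  case/or3P=> /eqP-> /or3P[]/eqP->; apply: comm_mx_horner;
    by apply: comm_horner_mx; first [exact: comm_mx_refl | exact: cAC | exact: cBC
      | exact: cAB | exact: comm_mx_sym cAC | exact: comm_mx_sym cBC | exact:
        comm_mx_sym].
case/and4P=> DC DA DB _.
have DT (i j : 'I_n.+1) : i != j -> (P *m T *m invmx P) i j = 0.
  move=> ij; have dgP X : similar_diag P X -> (P *m X *m invmx P) i j = 0.
    by move/(similar_diagP _ Pu); apply.
  rewrite /T mulmxBr mulmxBl mulmxDr mulmxDl mxE [X in _ + X]mxE [X in _ - X]mxE.
  by rewrite (dgP _ DC) (dgP _ DA) (dgP _ DB) !(addr0, oppr0).
have TP : P *m T = (P *m T *m invmx P) *m P by rewrite mulmxKV.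
apply/eqP; apply: contraT => T0.
have {T0} [i Ti] : exists i, (P *m T *m invmx P) i i != 0.
  apply/existsP; apply: contraR T0; rewrite negb_exists => /forallP DT0.
  suff E : P *m T *m invmx P = 0.
    by rewrite -(mulKmx Pu T) TP E mul0mx mulmx0.
  apply/matrixP => i j; rewrite [RHS]mxE; have [->|ij] := eqVneq i j;
    last exact: DT.
  by apply/eqP; rewrite -[_ == _]negbK DT0.
set t := (_ i i) in Ti.
have V0 : eigenspace T t != 0.
  have : (row i P <= eigenspace T t)%MS.
    apply/eigenspaceP; rewrite -row_mul TP row_mul.
    have -> : row i (P *m T *m invmx P) = t *: delta_mx 0 i.
      apply/rowP => j; rewrite [LHS]mxE [RHS]mxE [X in _ * X]mxE eqxx /=.
      have [->|ji] := eqVneq j i; first by rewrite mulr1.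
      by rewrite mulr0 DT // eq_sym.
    by rewrite -scalemxAl -rowE.
  apply: contraTneq => ->; rewrite submx0.
  apply/eqP => /(congr1 (mulmx^~ (invmx P))); rewrite mul0mx -row_mul mulmxV //.
  by move=> /rowP/(_ i); rewrite !mxE eqxx => /eqP; rewrite oner_eq0.
have [k [W fW eW]] := row_free_base V0.
have [A' WA] := stable_base eW (comm_mx_stable_eigenspace _ (cTX A erefl cAB)).
have [B' WB] := stable_base eW (comm_mx_stable_eigenspace _ (cTX B (comm_mx_sym
  cAB) erefl)).
have WC : W *m (A + B) = (A' + B') *m W by rewrite mulmxDr mulmxDl WA WB.
have WT : W *m T = t *: W by apply/eigenspaceP; rewrite eW.
have : horner_mx (A' + B') e - (horner_mx A' e + horner_mx B' e) = t%:M.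
  apply: (row_free_inj fW); rewrite mulmxBl mulmxDl.
  rewrite -(horner_mx_intertwine _ WC) -(horner_mx_intertwine _ WA).
  by rewrite -(horner_mx_intertwine _ WB) mul_scalar_mx -WT /T mulmxBr mulmxDr.
move/(congr1 mxtrace); rewrite raddfB raddfD /= mxtrace_scalar.
rewrite (averaging_trace av chiA fW WA) (averaging_trace av chiB fW WB).
rewrite (averaging_trace av chiC fW WC) raddfD /= subrr => /esym/eqP.
by rewrite -mulr_natr mulf_eq0 pnatr_eq0 orbF (negPf Ti).
Qed.

Lemma horner_mx_morph (K : comNzRingType) (n m : nat)
    (f : 'M[K]_n.+1 -> 'M[K]_m.+1) (A : 'M[K]_n.+1) (p : {poly K}) :
  {morph f : X Y / X + Y} -> {morph f : X Y / X *m Y} ->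
  (forall c, f c%:M = c%:M) -> f (horner_mx A p) = horner_mx (f A) p.
Proof.
move=> fD fM fC; elim/poly_ind: p => [|p c IHp].
  have s0 k : 0%:M = 0 :> 'M[K]_k by apply/matrixP => i j; rewrite !mxE mul0rn.
  by rewrite !rmorph0; have := fC 0; rewrite !s0.
by rewrite !rmorphD !rmorphM /= !horner_mx_X !horner_mx_C fD fM IHp fC.
Qed.

Lemma eq_mulmx_vec (K : comNzRingType) (m n p : nat) (A B : 'M[K]_(m * n, p)) :
  (forall X : 'M_(m, n), mxvec X *m A = mxvec X *m B) -> A = B.
Proof.
by move=> eAB; apply/row_matrixP => i; rewrite !rowE -(vec_mxK (delta_mx 0 i)) eAB.
Qed.

Lemma lin_mulmxM (K : comNzRingType) (n : nat) (A B : 'M[K]_n) :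
  lin_mulmx (A *m B) = lin_mulmx B *m lin_mulmx A :> 'M_(n * n).
Proof. by apply: eq_mulmx_vec => Z; rewrite mulmxA !mul_vec_lin /= mulmxA. Qed.

Lemma lin_mulmxrM (K : comNzRingType) (n : nat) (A B : 'M[K]_n) :
  lin_mulmxr (A *m B) = lin_mulmxr A *m lin_mulmxr B :> 'M_(n * n).
Proof. by apply: eq_mulmx_vec => Z; rewrite mulmxA !mul_vec_lin /= mulmxA. Qed.

Lemma lin_mulmx_scalar (K : comNzRingType) (n : nat) (c : K) :
  lin_mulmx (c%:M : 'M_n) = c%:M :> 'M_(n * n).
Proof.
apply: eq_mulmx_vec => Z.
by rewrite mul_vec_lin /= mul_scalar_mx linearZ /= -mul_mx_scalar.
Qed.

Lemma lin_mulmxr_scalar (K : comNzRingType) (n : nat) (c : K) :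
  lin_mulmxr (c%:M : 'M_n) = c%:M :> 'M_(n * n).
Proof.
apply: eq_mulmx_vec => Z.
by rewrite mul_vec_lin /= mul_mx_scalar linearZ /= -mul_mx_scalar.
Qed.

Lemma comm_lin_mulmx (K : comNzRingType) (n : nat) (A B : 'M[K]_n) :
  comm_mx (lin_mulmx A : 'M_(n * n)) (lin_mulmxr B).
Proof.
by apply: eq_mulmx_vec => Z; rewrite !mulmxA !mul_vec_lin /= mulmxA.
Qed.

(* A bilinear product on row vectors is encoded by the matrix [mu] with      *)
(* x . y = mxvec (x^T *m y) *m mu.                                            *)
Definition mx_derivation (K : comNzRingType) (n : nat) (mu : 'M[K]_(n * n, n))
    (D : 'M[K]_n) : Prop :=
  (lin_mulmx D^T + lin_mulmxr D) *m mu = mu *m D.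

Lemma mx_derivationP (K : comNzRingType) (n : nat) (mu : 'M[K]_(n * n, n))
    (D : 'M[K]_n) :
  mx_derivation mu D <->
  forall X, mxvec (D^T *m X + X *m D) *m mu = mxvec X *m mu *m D.
Proof.
have E X : mxvec X *m ((lin_mulmx D^T + lin_mulmxr D) *m mu)
    = mxvec (D^T *m X + X *m D) *m mu.
  by rewrite mulmxA mulmxDr !mul_vec_lin linearD.
split=> [dD X|dD]; first by rewrite -E dD mulmxA.
by apply: eq_mulmx_vec => X; rewrite E dD mulmxA.
Qed.

Lemma averaged_derivation (n : nat) (mu : 'M[rat]_(n.+1 * n.+1, n.+1))
    (D : 'M[rat]_n.+1) : mx_derivation mu D ->
  exists E, [/\ mx_derivation mu E, diagonalizable E, comm_mx E D &
    forall k (B : 'M_(k.+1, n.+1)) D' E', row_free B ->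
      B *m D = D' *m B -> B *m E = E' *m B -> \tr E' = \tr D'].
Proof.
move=> dD; pose m := (n + n * n.+1)%N.
pose fa (X : 'M[rat]_n.+1) : 'M[rat]_m.+1 :=
    (lin_mulmx X^T : 'M[rat]_(n.+1 * n.+1)).
pose fb (X : 'M[rat]_n.+1) : 'M[rat]_m.+1 :=
    (lin_mulmxr X : 'M[rat]_(n.+1 * n.+1)).
have fa_horner p : fa (horner_mx D p) = horner_mx (fa D) p.
  apply: horner_mx_morph => [X Y|X Y|c]; rewrite /fa.
  - by rewrite linearD /= linearD.
  - by rewrite trmx_mul; exact: (lin_mulmxM Y^T X^T).
  - by rewrite tr_scalar_mx; exact: (lin_mulmx_scalar n.+1 c).
have fb_horner p : fb (horner_mx D p) = horner_mx (fb D) p.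
  apply: horner_mx_morph => [X Y|X Y|c]; rewrite /fb.
  - by rewrite linearD.
  - exact: (lin_mulmxrM X Y).
  - exact: (lin_mulmxr_scalar n.+1 c).
pose chi := char_poly D * char_poly (fa D + fb D).
have chi0 : chi != 0 by rewrite mulf_neq0 ?monic_neq0 ?char_poly_monic.
have chiD : horner_mx D chi = 0 by rewrite rmorphM /= Cayley_Hamilton mul0r.
have [e av] := averaging_poly chi0.
have fab_comm : comm_mx (fa D) (fb D) by exact: (comm_lin_mulmx D^T D).
have fD : horner_mx (fa D + fb D) e = horner_mx (fa D) e + horner_mx (fb D) e.
  apply: (averagingD av) => //.
  - by rewrite -fa_horner chiD /fa trmx0 linear0.
  - by rewrite -fb_horner chiD /fb linear0.
  - by rewrite rmorphM /= Cayley_Hamilton mulr0.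
exists (horner_mx D e); split.
- rewrite /mx_derivation -/(fa _) -/(fb _) fa_horner fb_horner -fD.
  by apply/esym/horner_mx_intertwine/esym.
- exact: (av _ _ chiD).1.
- exact: comm_horner_mx.
move=> k B D' E' fB BD BE.
rewrite -(averaging_trace av chiD fB BD); congr mxtrace.
by apply: (row_free_inj fB); rewrite -BE (horner_mx_intertwine _ BD).
Qed.

(** * Perturbing a positive derivation *)

Lemma mulmx_row_tr (K : comNzRingType) (n : nat) (x y : 'rV[K]_n) :
  (x *m y^T) 0 0 = \sum_i x 0 i * y 0 i.
Proof. by rewrite mxE; apply: eq_bigr => i _; rewrite mxE. Qed.

Lemma row_sqr_ge0 (K : realDomainType) (n : nat) (x : 'rV[K]_n) :
  0 <= (x *m x^T) 0 0.
Proof. by rewrite mulmx_row_tr sumr_ge0 // => i _; rewrite -expr2 sqr_ge0. Qed.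

Lemma row_sqr_gt0 (K : realDomainType) (n : nat) (x : 'rV[K]_n) :
  x != 0 -> 0 < (x *m x^T) 0 0.
Proof.
move=> x0; rewrite lt_neqAle row_sqr_ge0 andbT eq_sym; apply: contra x0.
rewrite mulmx_row_tr psumr_eq0 => [/allP E|i _]; last by rewrite -expr2 sqr_ge0.
by apply/eqP/rowP => i; have := E i (mem_index_enum _);
  rewrite mulf_eq0 orbb mxE => /eqP.
Qed.

Lemma diag_perturb_gt0 (K : realFieldType) (n : nat) (d : 'rV[K]_n)
    (F : 'M[K]_n) (x : 'rV[K]_n) :
  (forall i, 1 <= d 0 i) -> \sum_i \sum_j `|F i j| < 1 -> x != 0 ->
  0 < (x *m (diag_mx d + F) *m x^T) 0 0.
Proof.
move=> d1 F1 x0; set q := (x *m x^T) 0 0; have q0 : 0 < q by exact: row_sqr_gt0.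
have xx i j : `|x 0 i * x 0 j| <= q.
  have le_q k : x 0 k ^+ 2 <= q.
    rewrite /q mulmx_row_tr (bigD1 k) //= expr2 lerDl sumr_ge0 // => l _.
    by rewrite -expr2 sqr_ge0.
  have [/= ] := (le_q i, le_q j).
  have := sqr_ge0 (x 0 i + x 0 j); have := sqr_ge0 (x 0 i - x 0 j).
  rewrite ler_norml; move: (x 0 i) (x 0 j) => a b; nra.
have lbF : - (q * \sum_i \sum_j `|F i j|) <= (x *m F *m x^T) 0 0.
  have -> : (x *m F *m x^T) 0 0 = \sum_i \sum_j F i j * (x 0 i * x 0 j).
    rewrite exchange_big mulmx_row_tr; apply: eq_bigr => j _.
    by rewrite mxE mulr_suml; apply: eq_bigr => i _; ring.
  rewrite mulr_sumr -sumrN ler_sum // => i _.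
  rewrite mulr_sumr -sumrN ler_sum // => j _.
  rewrite lerNl; apply: le_trans (ler_norm _) _.
  by rewrite normrN normrM mulrC ler_wpM2r.
have lbD : q <= (x *m diag_mx d *m x^T) 0 0.
  rewrite /q !mulmx_row_tr ler_sum // => i _; rewrite mul_mx_diag mxE.
  rewrite mulrAC -[leLHS]mulr1 ler_wpM2l //.
  by rewrite -expr2 sqr_ge0.
rewrite mulmxDr mulmxDl mxE;
  have := mulr_gt0 q0 (_ : 0 < 1 - \sum_i \sum_j `|F i j|).
rewrite subr_gt0 => /(_ F1); lra.
Qed.

Lemma ReD (R : rcfType) : {morph (@complex.Re R) : x y / x + y}.
Proof. by case=> a b [c d]. Qed.

Lemma ImD (R : rcfType) : {morph (@complex.Im R) : x y / x + y}.
Proof. by case=> a b [c d]. Qed.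

Lemma ReM (R : rcfType) (x y : R[i]) : complex.Re (x * y) =
  complex.Re x * complex.Re y - complex.Im x * complex.Im y.
Proof. by case: x y => a b [c d]. Qed.

Lemma ImM (R : rcfType) (x y : R[i]) : complex.Im (x * y) =
  complex.Re x * complex.Im y + complex.Im x * complex.Re y.
Proof. by case: x y => a b [c d]. Qed.

Lemma accretive_trace_gt0 (R : rcfType) (n k : nat) (G : 'M[R]_n)
    (B : 'M[R]_(k.+1, n)) (G' : 'M[R]_k.+1) :
  (forall x : 'rV_n, x != 0 -> 0 < (x *m G *m x^T) 0 0) ->
  row_free B -> B *m G = G' *m B -> 0 < \tr G'.
Proof.
move=> Gpos fB BG; pose C M N (A : 'M[R]_(M, N)) := map_mx (real_complex R) A.
have [r [charG trG]] := horner_mx_roots (C _ _ G').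
have Re_root z : z \in r -> 0 < complex.Re z.
  move=> zr; have : eigenvalue (C _ _ G') z.
    by rewrite eigenvalue_root_char charG root_prod_XsubC.
  case/eigenvalueP=> v vG v0; pose u := v *m C _ _ B.
  have u0 : u != 0 by rewrite mulmx_free_eq0 // /C row_free_map.
  have uG : u *m C _ _ G = z *: u.
    by rewrite /u -mulmxA -map_mxM BG map_mxM mulmxA vG scalemxAl.
  pose x := map_mx (@complex.Re R) u; pose y := map_mx (@complex.Im R) u.
  have xG : x *m G = complex.Re z *: x - complex.Im z *: y.
    apply/rowP => j; move/rowP/(_ j)/(congr1 (@complex.Re R)): uG.
    rewrite !mxE (big_morph _ (@ReD R) (erefl _)) => Ej.
    by rewrite -ReM -Ej; apply: eq_bigr => i _; rewrite !mxE ReM /= mulr0 subr0.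
  have yG : y *m G = complex.Re z *: y + complex.Im z *: x.
    apply/rowP => j; move/rowP/(_ j)/(congr1 (@complex.Im R)): uG.
    rewrite !mxE (big_morph _ (@ImD R) (erefl _)) => Ej.
    by rewrite -ImM -Ej; apply: eq_bigr => i _; rewrite !mxE ImM /= mulr0 add0r.
  have xy : (x *m y^T) 0 0 = (y *m x^T) 0 0.
    by rewrite !mulmx_row_tr; apply: eq_bigr => i _; rewrite mulrC.
  have E : (x *m G *m x^T) 0 0 + (y *m G *m y^T) 0 0
      = complex.Re z * ((x *m x^T) 0 0 + (y *m y^T) 0 0).
    rewrite xG yG mulmxBl mulmxDl -!scalemxAl mxE [in LHS]mxE.
    rewrite [X in _ + X + _]mxE [X in _ - X + _]mxE [X in _ + X]mxE.
    rewrite [X in _ + (X + _)]mxE [X in _ + (_ + X)]mxE xy; ring.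
  have [xge yge] := (row_sqr_ge0 x, row_sqr_ge0 y).
  have xy0 : 0 < (x *m x^T) 0 0 + (y *m y^T) 0 0.
    have [x0|/row_sqr_gt0] := eqVneq x 0; last by lra.
    have /row_sqr_gt0 : y != 0; last by lra.
    apply: contraNneq u0 => y0; apply/eqP/rowP => j; apply/eqP.
    have Rej : complex.Re (u 0 j) = 0.
      by transitivity (x 0 j); [rewrite [RHS]mxE | rewrite x0 mxE].
    have Imj : complex.Im (u 0 j) = 0.
      by transitivity (y 0 j); [rewrite [RHS]mxE | rewrite y0 mxE].
    rewrite [X in _ == X]mxE; move: Rej Imj.
    by case: (u 0 j) => c d /= -> ->.
  rewrite -(pmulr_lgt0 _ xy0) -E.
  have q0 (w : 'rV_n) : 0 <= (w *m G *m w^T) 0 0.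
    by have [->|/Gpos/ltW //] := eqVneq w 0; rewrite !mul0mx mxE.
  have [x0|/Gpos] := eqVneq x 0; last by have := q0 y; lra.
  have [y0|/Gpos] := eqVneq y 0; last by have := q0 x; lra.
  by move: xy0; rewrite x0 y0 !mul0mx !mxE addr0 ltxx.
have -> : \tr G' = \sum_(z <- r) complex.Re z.
  transitivity (complex.Re (\tr (C _ _ G'))).
    rewrite /mxtrace (big_morph _ (@ReD R) (erefl _)).
    by apply: eq_bigr => i _; rewrite mxE.
  have := trG 'X; rewrite horner_mx_X => ->.
  rewrite (big_morph _ (@ReD R) (erefl _)).
  by apply: eq_bigr => z _; rewrite hornerX.
have : size r = k.+1.
  have := size_char_poly (C _ _ G'); rewrite charG size_prod_XsubC => -[] //.
case: r Re_root {charG trG} => // z r Re_root _.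
rewrite big_cons ltr_pwDl ?Re_root ?mem_head // big_seq sumr_ge0 // => w wr.
by rewrite ltW // Re_root // in_cons wr orbT.
Qed.

Lemma rational_kernel_approx (R : realType) (m q p : nat) (Th : 'M[rat]_(m, q))
    (M : 'M[R]_(m, p)) (v : 'rV[R]_m) : v *m map_mx ratr Th = 0 ->
  exists2 u : 'rV[rat]_m, u *m Th = 0 &
    \sum_j `|((map_mx ratr u - v) *m M) 0 j| < 1.
Proof.
move=> /sub_kermxP; rewrite -map_kermx => /submxP[a ->]; set K := kermx Th.
pose N := map_mx ratr K *m M.
pose S := \sum_k \sum_j `|N k j|.
have S0 : 0 <= S by rewrite sumr_ge0 // => k _; rewrite sumr_ge0.
pose dl := (1 + S)^-1; have dl0 : 0 < dl by rewrite invr_gt0 ltr_wpDr.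
have ex k : exists b : rat, `|ratr b - a 0 k| < dl.
  have [b] := @rat_in_itvoo R (a 0 k - dl) (a 0 k + dl) ltac:(lra).
  by rewrite in_itv /= -ltr_distlC distrC => hb; exists b.
pose b := \row_k xchoose (ex k).
exists (b *m K); first by rewrite -mulmxA mulmx_ker mulmx0.
rewrite map_mxM -mulmxBl -mulmxA -/N.
apply: (@le_lt_trans _ _ (dl * S)); last first.
  have S1 : 0 < 1 + S by lra.
  by rewrite mulrC ltr_pdivrMr // mul1r; lra.
rewrite /S exchange_big mulr_sumr ler_sum // => j _.
rewrite mxE (le_trans (ler_norm_sum _ _ _)) // mulr_sumr ler_sum // => k _.
rewrite normrM ler_wpM2r // !mxE ltW //; exact: xchooseP (ex k).
Qed.

Definition derivation_defect (K : comNzRingType) (n : nat)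
    (mu : 'M[K]_(n * n, n)) (D : 'M[K]_n) : 'M[K]_(n * n, n) :=
  (lin_mulmx D^T + lin_mulmxr D) *m mu - mu *m D.

Fact derivation_defect_is_linear (K : comNzRingType) (n : nat)
  (mu : 'M[K]_(n * n, n)) : linear (derivation_defect mu).
Proof.
move=> a X Y; rewrite /derivation_defect !linearP /=.
by rewrite addrACA -scalerDr mulmxDl -scalemxAl addrACA -scalerDr.
Qed.

HB.instance Definition _ (K : comNzRingType) (n : nat) (mu : 'M[K]_(n * n, n)) :=
  GRing.isLinear.Build K _ _ *:%R (derivation_defect mu)
    (derivation_defect_is_linear mu).

Lemma mx_derivation_ker (K : comNzRingType) (n : nat) (mu : 'M[K]_(n * n, n))
    (D : 'M[K]_n) :
  mx_derivation mu D <-> mxvec D *m lin_mx (derivation_defect mu) = 0.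
Proof.
rewrite mul_vec_lin /mx_derivation /=; split=> [dD|/eqP].
  by rewrite /derivation_defect dD subrr linear0.
by rewrite mxvec_eq0 subr_eq0 => /eqP.
Qed.

Lemma map_derivation_defect (K K' : comNzRingType) (f : {rmorphism K -> K'})
    (n : nat) (mu : 'M[K]_(n * n, n)) :
  map_mx f (lin_mx (derivation_defect mu))
    = lin_mx (derivation_defect (map_mx f mu)).
Proof.
apply: map_lin_mx => A; rewrite /derivation_defect map_mxB !map_mxM map_mxD.
rewrite map_trmx; congr ((_ + _) *m _ - _); apply: map_lin_mx => X /=.
  by rewrite map_mxM.
by rewrite map_mxM.
Qed.

Lemma mx_derivationZ (K : comNzRingType) (n : nat) (mu : 'M[K]_(n * n, n))
    (a : K) (D : 'M[K]_n) : mx_derivation mu D -> mx_derivation mu (a *: D).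
Proof. by rewrite !mx_derivation_ker linearZ /= -scalemxAl => ->;
  rewrite scaler0. Qed.

Lemma clear_denominators (T : finType) (d : T -> rat) : (forall i, 0 < d i) ->
  exists2 N : nat, (0 < N)%N &
    exists2 w : T -> nat, (forall i, 0 < w i)%N &
      forall i, (w i)%:R = N%:R * d i.
Proof.
move=> d0; pose c i := `|denq (d i)|%N; pose N := (\prod_i c i)%N.
have c0 i : (0 < c i)%N by rewrite absz_gt0 denq_neq0.
have N0 : (0 < N)%N by rewrite prodn_gt0.
exists N => //; exists (fun i => `|numq (d i)| * \prod_(j | j != i) c j)%N => i.
  by rewrite muln_gt0 prodn_gt0 // andbT absz_gt0 numq_eq0 gt_eqF.
have -> : N = (c i * \prod_(j | j != i) c j)%N by rewrite /N (bigD1 i).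
rewrite !natrM mulrC -mulrA mulrCA; congr (_ * _).
rewrite -[d i in RHS]divq_num_den /c.
have E (z : int) : 0 < z -> (`|z|%N)%:R = z%:~R :> rat.
  by move=> z0; rewrite pmulrn gtz0_abs.
rewrite !E ?denq_gt0 // ?numq_gt0 //.
by rewrite mulrC divfK // intr_eq0 denq_neq0.
Qed.

Lemma graded_descent (R : realType) (n : nat)
    (mu : 'M[rat]_(n.+1 * n.+1, n.+1)) (P : 'M[R]_n.+1) (w : 'I_n.+1 -> nat) :
  P \in unitmx -> (forall i, 0 < w i)%N ->
  mx_derivation (map_mx ratr mu) (invmx P *m diag_mx (\row_i (w i)%:R) *m P) ->
  exists Q : 'M[rat]_n.+1, exists w' : 'I_n.+1 -> nat,
    [/\ Q \in unitmx, (forall i, 0 < w' i)%N &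
      mx_derivation mu (invmx Q *m diag_mx (\row_i (w' i)%:R) *m Q)].
Proof.
move=> Pu w0; set D0 := _ *m _ *m P.
move/mx_derivation_ker; rewrite -map_derivation_defect.
pose cj (X : 'M[R]_n.+1) := P *m X *m invmx P.
pose Lcj : {linear 'M[R]_n.+1 -> 'M[R]_n.+1} := mulmxr (invmx P) \o mulmx P.
move/(rational_kernel_approx (lin_mx Lcj)) => [u uTh near_u].
pose D := vec_mx u; pose DR := map_mx (@ratr R) D.
have dD : mx_derivation mu D by apply/mx_derivation_ker; rewrite vec_mxK.
pose F := cj (DR - D0).
have F1 : \sum_i \sum_j `|F i j| < 1.
  apply: le_lt_trans near_u; rewrite pair_bigA /=.
  rewrite (reindex _ (curry_mxvec_bij _ _)) /= ler_sum // => -[i j] _ /=.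
  rewrite -[map_mx _ u]vec_mxK -linearB /=.
  by rewrite (mul_vec_lin Lcj) mxvecE /= -map_vec_mx.
have cjD : P *m DR *m invmx P = diag_mx (\row_i (w i)%:R) + F.
  rewrite /F /cj mulmxBr mulmxBl addrC /D0 !mulmxA mulmxV // mul1mx mulmxK //.
  by rewrite subrK.
have [E [dE [Q Qu]]] := averaged_derivation dD.
case/similar_diagPex=> d /(similarLR Qu); rewrite conjVmx // => EQ cED trE.
have d_gt0 i : 0 < d 0 i.
  have V0 : eigenspace E (d 0 i) != 0.
    have : (row i Q <= eigenspace E (d 0 i))%MS.
      apply/eigenspaceP; rewrite EQ !mulmxA -row_mul mulmxV // rowE mulmx1.
      by rewrite -rowE row_diag_mx -scalemxAl -rowE.
    apply: contraTneq => ->; rewrite submx0.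
    apply/eqP => /(congr1 (mulmx^~ (invmx Q))); rewrite mul0mx -row_mul mulmxV //.
    by move=> /rowP/(_ i); rewrite !mxE eqxx => /eqP; rewrite oner_eq0.
  have [k [B fB eB]] := row_free_base V0.
  have [D' BD] := stable_base eB (comm_mx_stable_eigenspace _ cED).
  have BE : B *m E = (d 0 i)%:M *m B.
    by rewrite mul_scalar_mx; apply/eigenspaceP; rewrite eB.
  have := trE _ _ _ _ fB BD BE; rewrite mxtrace_scalar => tr_d.
  have : 0 < \tr (map_mx (@ratr R) D').
    apply: (@accretive_trace_gt0 _ _ _ (P *m DR *m invmx P) (map_mx ratr B *m
      invmx P)).
    - move=> x x0; rewrite cjD; apply: diag_perturb_gt0 => // j.
      by rewrite mxE ler1n.
    - by rewrite /row_free mxrankMfree ?row_free_unit ?unitmx_inv //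
      -/(row_free _) row_free_map.
    - by rewrite !mulmxA mulmxKV // -map_mxM BD map_mxM.
  rewrite -[\tr _](_ : ratr (\tr D') = _); last first.
    by rewrite /mxtrace rmorph_sum; apply: eq_bigr => j _; rewrite mxE.
  by rewrite ltr0q -tr_d pmulrn_lgt0.
have [N N0 [w' w'0 w'E]] := clear_denominators d_gt0.
exists Q, w'; split=> //.
have -> : \row_i (w' i)%:R = N%:R *: d by apply/rowP => i; rewrite !mxE w'E.
rewrite linearZ /= -scalemxAr -scalemxAl -EQ; exact: mx_derivationZ.
Qed.

(** * A unimodular matrix with real eigenvalues *)

Definition stair_poly (K : nzRingType) (s : nat) : {poly K} :=
  \prod_(j < s) ('X - (3 * j)%:R%:P) - 1.

Lemma map_stair_poly (K K' : nzRingType) (f : {rmorphism K -> K'}) (s : nat) :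
  map_poly f (stair_poly K s) = stair_poly K' s.
Proof.
rewrite /stair_poly rmorphB rmorph1 rmorph_prod; congr (_ - _).
by apply: eq_bigr => j _; rewrite rmorphB /= map_polyX map_polyC /= rmorph_nat.
Qed.

Lemma size_stair_prod (K : nzRingType) (s : nat) :
  size (\prod_(j < s) ('X - (3 * j)%:R%:P) : {poly K}) = s.+1.
Proof. by rewrite size_prod_XsubC [index_enum _]unlock -enumT size_enum_ord. Qed.

Lemma size_stair_poly (K : nzRingType) (s : nat) : (0 < s)%N ->
  size (stair_poly K s) = s.+1.
Proof.
by move=> s0; rewrite /stair_poly size_polyDl ?size_stair_prod // size_polyN
  size_poly1.
Qed.

Lemma stair_poly_monic (K : nzRingType) (s : nat) : (0 < s)%N ->
  stair_poly K s \is monic.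
Proof.
move=> s0; rewrite monicE lead_coefDl ?lead_coef_prod_XsubC //.
by rewrite size_stair_prod size_polyN size_poly1.
Qed.

Lemma horner_stair_poly (K : comNzRingType) (s : nat) (x : K) :
  (stair_poly K s).[x] = \prod_(j < s) (x - (3 * j)%:R) - 1.
Proof.
by rewrite !hornerE horner_prod; congr (_ - _); apply: eq_bigr => j _;
  rewrite !hornerE.
Qed.

Lemma stair_poly_coef0 (K : comNzRingType) (s : nat) : (0 < s)%N ->
  (stair_poly K s)`_0 = -1.
Proof.
case: s => // s _; rewrite -horner_coef0 horner_stair_poly big_ord_recl.
by rewrite muln0 subr0 mul0r sub0r.
Qed.

Lemma prod_ge2 (K : realDomainType) (s : nat) (i : 'I_s) (a : 'I_s -> K) :
  (forall j, 1 <= a j) -> 2 <= a i -> 2 <= \prod_j a j.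
Proof.
move=> a1 ai; rewrite (bigD1 i) //= -[2]mulr1 ler_pM ?ler0n //.
by elim/big_ind: _ => // x y x1 y1; rewrite -[1]mulr1 ler_pM.
Qed.

(* Between consecutive points of the progression 3 i - 2 the product        *)
(* changes sign, and its absolute value there is at least 2.                *)
Lemma stair_poly_sign (R : realFieldType) (s i : nat) : (2 <= s)%N -> (i < s)%N ->
  exists e : R, [/\ e ^+ 2 = 1,
    0 < e * (stair_poly R s).[(3 * i)%:R - 2] &
    e * (stair_poly R s).[(3 * i.+1)%:R - 2] < 0].
Proof.
move=> s2 lt_is; pose sg k (j : 'I_s) : R := if (j < k)%N then 1 else -1.
pose a k (j : 'I_s) : R := sg k j * ((3 * k)%:R - 2 - (3 * j)%:R).
have a1 k j : 1 <= a k j.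
  rewrite /a /sg !natrM; have [lt_jk|le_kj] := ltnP j k.
    have : (j.+1)%:R <= k%:R :> R by rewrite ler_nat.
    by rewrite -natr1; lra.
  have : k%:R <= j%:R :> R by rewrite ler_nat.
  by lra.
have a2 k : (k <= s)%N -> 2 <= \prod_j a k j.
  rewrite leq_eqVlt => /orP[/eqP->|lt_ks].
    apply: (prod_ge2 (i := Ordinal (ltnW s2))) (a1 s) _.
    rewrite /a /sg /= (ltnW s2) muln0 natrM.
    have : 2 <= s%:R :> R by rewrite (ler_nat _ 2).
    by lra.
  apply: (prod_ge2 (i := Ordinal lt_ks)) (a1 k) _.
  by rewrite /a /sg /= ltnn; lra.
pose e k := \prod_j sg k j.
have eE k : \prod_j a k j = e k * \prod_(j < s) ((3 * k)%:R - 2 - (3 * j)%:R).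
  by rewrite -big_split.
have e2 k : e k ^+ 2 = 1.
  rewrite /e -prodrXl big1 // => j _; rewrite /sg.
  by case: ifP => _; rewrite ?sqrrN expr1n.
have eS : e i.+1 = - e i.
  rewrite /e (bigD1 (Ordinal lt_is)) //= [in RHS](bigD1 (Ordinal lt_is)) //=
    /sg ltnSn ltnn !mul1r mulN1r opprK.
  apply: eq_bigr => j /negPf ji; congr (if _ then _ else _).
  by rewrite ltnS leq_eqVlt -[j == i :> nat]/(j == Ordinal lt_is) ji.
have [h1 h2] := (a2 i (ltnW lt_is), a2 i.+1 lt_is).
exists (e i); split; rewrite ?horner_stair_poly //.
  move: h1 (e2 i); rewrite eE; set q := \prod_j _ => h1 h2'; nra.
move: h2 (e2 i); rewrite eE eS; set q := \prod_j _ => h1' h2'; nra.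
Qed.

Lemma stair_poly_roots (R : rcfType) (s : nat) : (2 <= s)%N ->
  exists th : 'I_s -> R, [/\ injective th,
    forall k, root (stair_poly R s) (th k) & forall k, `|th k| != 1].
Proof.
move=> s2; have ex (k : 'I_s) : exists x : R, root (stair_poly R s) x &&
    ((3 * k)%:R - 2 < x < (3 * k)%:R + 1).
  have [e [e2 h1 h2]] := stair_poly_sign R s2 (ltn_ord k).
  have e0 : e != 0 by apply/eqP => e0; move: e2; rewrite e0 expr0n /=; lra.
  have [|/=|x] := @poly_ivt R (- e *: stair_poly R s)
      ((3 * k)%:R - 2) ((3 * k.+1)%:R - 2).
  - by rewrite mulnS natrD; lra.
  - by rewrite !hornerZ; apply/andP; split; lra.
  rewrite rootZ ?oppr_eq0 // => /andP[x1 x2] rx; exists x; rewrite rx /=.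
  have E1 : (3 * k)%:R + 1 = (3 * k.+1)%:R - 2 :> R by rewrite mulnS natrD; ring.
  rewrite E1 !lt_neqAle x1 x2 !andbT; apply/andP; split; apply: contraTneq rx => E.
    by rewrite -E /root; apply/eqP => E'; move: h1; rewrite E' mulr0 ltxx.
  by rewrite E /root; apply/eqP => E'; move: h2; rewrite E' mulr0 ltxx.
have [th th_root'] : exists th : 'I_s -> R, forall k, root (stair_poly R s) (th
  k) &&
    ((3 * k)%:R - 2 < th k < (3 * k)%:R + 1).
  by exists (fun k => xchoose (ex k)) => k; exact: (xchooseP (ex k)).
have th_root k := andP (th_root' k).
exists th; split=> [k l|k|k].
- wlog: k l / (k <= l)%N => [H|].
    by have [/H//|/ltnW/H E /esym/E/esym] := leqP k l.
  rewrite leq_eqVlt => /orP[/eqP kl _|lt_kl E]; first exact/val_inj.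
  have [[_ /andP[_ h1]] [_ /andP[h2 _]]] := (th_root k, th_root l).
  exfalso; move: h1 h2; rewrite E !natrM.
  have : (k.+1)%:R <= l%:R :> R by rewrite ler_nat.
  by rewrite -natr1; lra.
- by have [] := th_root k.
have [rt /andP[h1 h2]] := th_root k; move: (th k) rt h1 h2 => x rt h1 h2.
apply/negP; rewrite eqr_norml ler01 andbT => /orP[]/eqP x1.
  move: h1 h2; rewrite x1 natrM.
  case: k => -[|k] ltk /=; first by rewrite mulr0; lra.
  by have : 0 <= k%:R :> R by []; rewrite -natr1; lra.
move: rt; rewrite /root horner_stair_poly x1 subr_eq0 => /eqP.
move/(congr1 Num.norm); rewrite normr1 normr_prod => E.
have aE (j : 'I_s) : `|-1 - (3 * j)%:R| = 1 + (3 * j)%:R :> R.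
  by rewrite -opprD normrN ger0_norm // addr_ge0.
have := @prod_ge2 R s (Ordinal s2) (fun j => `|-1 - (3 * j)%:R|).
rewrite E !aE /= muln1 => H; suff : 2 <= 1 :> R by lra.
apply: H => [j|]; last by lra.
by rewrite aE lerDl.
Qed.

Lemma companion_Vandermonde (K : comNzRingType) (p : {poly int})
    (th : 'I_(size p).-1 -> K) :
  p \is monic -> (forall k, root (map_poly intr p) (th k)) ->
  let V := Vandermonde (size p).-1 (\row_k th k) in
  map_mx intr (companionmx p) *m V = V *m diag_mx (\row_k th k).
Proof.
move=> mp rp V; apply/matrixP => i k; rewrite mul_mx_diag !mxE -exprSr.
have sp : size p = (size p).-1.+1 by rewrite prednK // size_poly_gt0 monic_neq0.
have [i_max|i_small] := boolP (i == (size p).-1.-1 :> nat); last first.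
  have lti : (i.+1 < (size p).-1)%N.
    have aux a b : (a < b -> a != b.-1 -> a.+1 < b)%N by case: b => //= b;
      rewrite !ltnS leq_eqVlt => /orP[->|].
    exact: aux.
  rewrite (bigD1 (Ordinal lti)) //= !mxE (negPf i_small) eqxx mul1r.
  rewrite big1 ?addr0 // => j ji; rewrite !mxE (negPf i_small).
  by rewrite -[i.+1 == j]/(i.+1 == val j) eq_sym -val_eqE /= in ji *;
    rewrite (negPf ji) mul0r.
have := rp k; rewrite /root horner_coef size_map_poly_id0; last first.
  by rewrite (monicP mp) oner_eq0.
rewrite -(big_mkord xpredT (fun j => (map_poly intr p)`_j * th k ^+ j)).
rewrite [X in index_iota 0 X]sp big_nat_recr //= big_mkord coef_map /=
  -lead_coefE (monicP mp) mul1r.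
have -> : i.+1 = (size p).-1.
  by rewrite (eqP i_max) prednK // (leq_ltn_trans _ (ltn_ord i)).
rewrite addr_eq0 => /eqP/(canLR (@opprK _)) <-; rewrite -sumrN;
  apply: eq_bigr => j _.
by rewrite !mxE i_max coef_map /= rmorphN mulNr.
Qed.

Lemma unimodular_diagonalized (R : realType) (s : nat) : (2 <= s)%N ->
  exists C : 'M[int]_s, exists th : 'I_s -> R,
  [/\ C \in unitmx, Vandermonde s (\row_k th k) \in unitmx,
    map_mx intr C *m Vandermonde s (\row_k th k)
      = Vandermonde s (\row_k th k) *m diag_mx (\row_k th k) &
    forall k, `|th k| != 1].
Proof.
move=> s2; have s0 := ltnW s2;
  have [th [th_inj th_root th1]] := stair_poly_roots R s2.
have Vu : Vandermonde s (\row_k th k) \in unitmx.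
  rewrite unitmxE det_Vandermonde unitfE; apply/prodf_neq0 => i _.
  apply/prodf_neq0 => j lt_ij; rewrite !mxE subr_eq0 (inj_eq th_inj).
  by rewrite neq_ltn lt_ij orbT.
pose p := stair_poly int s; have mp : p \is monic by exact: stair_poly_monic.
have sp : (size p).-1 = s by rewrite size_stair_poly.
suff [C Cu CV] : exists2 C : 'M[int]_s, C \in unitmx &
    map_mx intr C *m Vandermonde s (\row_k th k)
      = Vandermonde s (\row_k th k) *m diag_mx (\row_k th k).
  by exists C, th.
have {}th_root k : root (map_poly intr p) (th k) by rewrite map_stair_poly.
have p0 : p`_0 = -1 by exact: stair_poly_coef0.
clearbody p; clear th_inj th1 Vu s2 s0.
case: s / sp th th_root => th th_root; exists (companionmx p).
  have := char_poly_det (companionmx p); rewrite companionmxK // p0 unitmxE => E.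
  by have := unitrN1 int; rewrite E unitrM => /andP[].
exact: companion_Vandermonde.
Qed.

Definition weight_act (K : comNzRingType) (n s : nat) (w : 'I_n -> nat)
    (C : 'M[K]_s) (X : 'M[K]_(n, s)) : 'M[K]_(n, s) :=
  \matrix_l (row l X *m C ^+ w l).

Lemma row_weight_act (K : comNzRingType) (n s : nat) (w : 'I_n -> nat)
    (C : 'M[K]_s) (X : 'M[K]_(n, s)) (l : 'I_n) :
  row l (weight_act w C X) = row l X *m C ^+ w l.
Proof. exact: rowK. Qed.

Fact weight_act_is_linear (K : comNzRingType) (n s : nat) (w : 'I_n -> nat)
  (C : 'M[K]_s) : linear (@weight_act K n s w C).
Proof.
move=> a X Y; apply/row_matrixP => l.
by rewrite linearP /= !row_weight_act linearP /= mulmxDl -scalemxAl.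
Qed.

HB.instance Definition _ (K : comNzRingType) (n s : nat) (w : 'I_n -> nat)
    (C : 'M[K]_s) :=
  GRing.isLinear.Build K _ _ *:%R (@weight_act K n s w C)
    (weight_act_is_linear w C).

Lemma map_mxX (K K' : comNzRingType) (f : {rmorphism K -> K'}) (s k : nat)
    (C : 'M[K]_s) : map_mx f (C ^+ k) = (map_mx f C) ^+ k.
Proof.
elim: k => [|k IHk]; first by rewrite !expr0 map_mx1.
by rewrite !exprS map_mxM IHk.
Qed.

Lemma map_weight_act (K K' : comNzRingType) (f : {rmorphism K -> K'}) (n s : nat)
    (w : 'I_n -> nat) (C : 'M[K]_s) (X : 'M[K]_(n, s)) :
  map_mx f (weight_act w C X) = weight_act w (map_mx f C) (map_mx f X).
Proof.
apply/row_matrixP => l.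
by rewrite -map_row !row_weight_act map_mxM map_mxX map_row.
Qed.

Lemma weight_actK (K : comUnitRingType) (n s : nat) (w : 'I_n -> nat)
    (C : 'M[K]_s) : C \in unitmx ->
  cancel (@weight_act K n s w C) (weight_act w (invmx C)).
Proof.
move=> Cu X; apply/row_matrixP => l; rewrite !row_weight_act -mulmxA.
have -> : C ^+ w l *m invmx C ^+ w l = 1%:M; last by rewrite mulmx1.
elim: (w l) => [|k IHk]; first by rewrite !expr0 mulmx1.
by rewrite exprS exprSr !mulmxA -[_ *m _ *m _ *m _]mulmxA mulmxA -(mulmxA C)
  IHk mulmx1 mulmxV.
Qed.

Lemma lin_weight_act_unit (K : comUnitRingType) (n s : nat) (w : 'I_n -> nat)
    (C : 'M[K]_s) : C \in unitmx ->
  lin_mx (@weight_act K n s w C) \in unitmx.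
Proof.
move=> Cu; have E : lin_mx (@weight_act K n s w C)
    *m lin_mx (@weight_act K n s w (invmx C)) = 1%:M.
  apply: eq_mulmx_vec => X.
  by rewrite mulmxA !mul_vec_lin /= weight_actK // mulmx1.
by have [] := mulmx1_unit E.
Qed.

Lemma expr_diag_mx (K : comNzRingType) (s k : nat) (d : 'rV[K]_s) :
  (diag_mx d) ^+ k = diag_mx (\row_i d 0 i ^+ k).
Proof.
elim: k => [|k IHk].
  rewrite expr0 -[1]/(1%:M) -diag_const_mx; congr diag_mx.
  by apply/rowP => i; rewrite !mxE expr0.
rewrite exprS IHk -[_ * _]/(_ *m _) mulmx_diag; congr diag_mx.
by apply/rowP => i; rewrite !mxE exprS.
Qed.

Lemma intertwine_expr (K : comNzRingType) (s k : nat) (C V D : 'M[K]_s) :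
  C *m V = V *m D -> C ^+ k *m V = V *m D ^+ k.
Proof.
move=> CV; elim: k => [|k IHk]; first by rewrite !expr0 mul1mx mulmx1.
by rewrite !exprS -mulmxA IHk !mulmxA CV.
Qed.

Lemma injective_dim (K : fieldType) (U W : vectType K) (f : {linear U -> W}) :
  injective f -> (\dim (fullv : {vspace U}) <= \dim (fullv : {vspace W}))%N.
Proof.
move=> f_inj; have := limg_ker_dim (linfun f) fullv.
have /eqP-> : lker (linfun f) == 0%VS.
  by apply/lker0P => x y; rewrite !lfunE; apply: f_inj.
by rewrite capv0 dimv0 add0n => <-; rewrite dimvS ?subvf.
Qed.

Lemma linear_can (K : fieldType) (U W : vectType K) (f : {linear U -> W}) g :
  cancel f g -> cancel g f -> linear g.
Proof.
by move=> fK gK a x y; apply: (can_inj fK); rewrite linearP /= !gK.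
Qed.

Lemma bijective_dim (K : fieldType) (U W : vectType K) (f : {linear U -> W}) :
  bijective f -> \dim (fullv : {vspace U}) = \dim (fullv : {vspace W}).
Proof.
case=> g fK gK; pose gL : {linear W -> U} :=
  HB.pack g (GRing.isLinear.Build _ _ _ _ g (linear_can fK gK)).
apply/eqP; rewrite eqn_leq (injective_dim (can_inj fK)).
exact: (@injective_dim _ _ _ gL (can_inj gK)).
Qed.

Lemma dim_row (K : fieldType) (d : nat) :
  \dim (fullv : {vspace 'rV[K]_d}) = d.
Proof. by rewrite dimvf /dim /= mul1n. Qed.

Lemma unimodular_hyperbolic (R : realType) (W : vectType rat) (A : 'End(W))
    (d : nat) (phi : {linear W -> 'rV[rat]_d}) (M : 'M[int]_d) :
  bijective phi -> M \in unitmx ->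
  (forall v, phi (A v) = phi v *m map_mx intr M) ->
  (forall z : R[i], eigenvalue (map_mx intr M) z -> `|z| != 1) ->
  unimodular A /\ hyperbolic R A.
Proof.
move=> phi_bij; have := bijective_dim phi_bij; rewrite dim_row => dE.
case: d / dE phi M phi_bij => phi M [psi phiK psiK] Mu phiA hypM.
set d := \dim _ in phi M psi phiK psiK Mu phiA hypM *.
pose b := [tuple psi (delta_mx 0 i) | i < d].
have bE (i : 'I_d) : b`_i = psi (delta_mx 0 i).
  by rewrite -tnth_nth tnth_mktuple.
have phi_sum (v : 'rV[rat]_d) : phi (\sum_i v 0 i *: b`_i) = v.
  rewrite linear_sum [RHS]row_sum_delta /=; apply: eq_bigr => i _.
  by rewrite linearZ /= bE psiK.
have b_basis : basis_of fullv b.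
  rewrite basisEfree size_tuple leqnn subvf !andbT.
  apply/freeP => k kb i; have := phi_sum (\row_j k j).
  under eq_bigr => j _ do rewrite mxE.
  by rewrite kb linear0 => /rowP/(_ i); rewrite !mxE.
have rVb v : rVof b v = phi v by rewrite -[v in RHS](rVofK b_basis) phi_sum.
have bM : mxof b b A = map_mx intr M.
  apply/row_matrixP => i; rewrite !rowE mul_mxof rVb phiA -rVb vecofK //.
split; first by exists b, M.
move=> z /eigenvalueP[v vA v0]; apply: hypM.
pose Q : 'M[rat]_d := \matrix_i phi (vbasis (fullv : {vspace W}))`_i.
have vbB : basis_of fullv (vbasis (fullv : {vspace W})) by exact: vbasisP.
have rVQ x : rVof (vbasis fullv) x *m Q = phi x.
  rewrite -[x in RHS](rVofK vbB) linear_sum /= mulmx_sum_row.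
  by apply: eq_bigr => i _; rewrite rowK linearZ.
have QM : mxof (vbasis fullv) (vbasis fullv) A *m Q = Q *m map_mx intr M.
  apply/row_matrixP => i; rewrite !row_mul rowE mul_mxof rVQ phiA.
  by rewrite vecof_delta rowK.
have Qu : Q \in unitmx.
  rewrite -row_full_unit -sub1mx; apply/row_subP => i.
  rewrite row1 -(psiK (delta_mx 0 i)) -rVQ; exact: submxMl.
apply/eigenvalueP; exists (v *m map_mx ratr Q).
  rewrite -mulmxA; have -> : map_mx intr M = map_mx (@ratr R[i]) (map_mx intr M).
    by apply/matrixP => i j; rewrite !mxE ratr_int.
  by rewrite -map_mxM -QM map_mxM mulmxA vA scalemxAl.
by rewrite mulmx_free_eq0 // row_free_unit map_unitmx.
Qed.

Lemma weight_act_eigenvalue (R : realType) (n s : nat) (w : 'I_n -> nat)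
    (C : 'M[int]_s) (th : 'I_s -> R) (V : 'M[R]_s) :
  (forall l, 0 < w l)%N -> V \in unitmx ->
  map_mx intr C *m V = V *m diag_mx (\row_k th k) ->
  (forall k, `|th k| != 1) ->
  forall z : R[i],
    eigenvalue (map_mx intr (lin_mx (@weight_act _ n s w C))) z -> `|z| != 1.
Proof.
move=> w0 Vu CV th1 z /eigenvalueP[v].
rewrite (map_lin_mx (gf := weight_act w (map_mx intr C))); last first.
  exact: map_weight_act.
rewrite mul_rV_lin => vz v0; pose X := vec_mx v.
have XC l : row l X *m (map_mx intr C) ^+ w l = z *: row l X.
  rewrite -row_weight_act; have := congr1 vec_mx vz.
  by rewrite mxvecK linearZ /= => ->; rewrite linearZ.
have X0 : X != 0 by rewrite vec_mx_eq0.
have [l Xl] : exists l, row l X != 0.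
  apply/existsP; apply: contraR X0; rewrite negb_exists => /forallP E.
  by apply/eqP/row_matrixP => l; rewrite row0; apply/eqP/negbNE.
pose VC := map_mx (real_complex R) V; pose y := row l X *m VC.
have y0 : y != 0 by rewrite mulmx_free_eq0 // row_free_unit map_unitmx.
have [k yk] : exists k, y 0 k != 0.
  apply/existsP; apply: contraR y0; rewrite negb_exists => /forallP E.
  by apply/eqP/rowP => k; rewrite [RHS]mxE; apply/eqP/negbNE.
have CVC : map_mx intr C *m VC = VC *m map_mx (real_complex R) (diag_mx (\row_k
  th k)).
  rewrite /VC -map_mxM -CV map_mxM; congr (_ *m _).
  by apply/matrixP => i j; rewrite !mxE rmorph_int.
have := congr1 (fun u : 'rV_s => (u *m VC) 0 k) (XC l).
rewrite /= -mulmxA (intertwine_expr _ CVC) -map_mxX expr_diag_mx map_diag_mx.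
rewrite mulmxA -scalemxAl -/y mul_mx_diag [LHS]mxE [RHS]mxE mulrC.
move/(mulIf yk) <-; rewrite !mxE normc_def /= expr0n addr0 sqrtr_sqr.
rewrite (inj_eq (@complexI R)) normrX pexpr_eq1 ?w0 ?normr_ge0 ?th1 //.
Qed.

(** * The twisted rational form *)

Lemma semilinear_injective_lie (R : realType) (N : lieAlgType R) (U : vectType rat)
    (iota : U -> N) (br : U -> U -> U) :
  linear_for (@ratr R \; *:%R) iota -> injective iota ->
  (forall x y, iota (br x y) = lie (iota x) (iota y)) ->
  [/\ forall y, linear (br^~ y), forall x, linear (br x),
      forall x, br x x = 0 &
      forall x y z, br x (br y z) + br y (br z x) + br z (br x y) = 0].
Proof.
move=> lin inj brE.
have iZD a x y : iota (a *: x + y) = ratr a *: iota x + iota y by exact: lin.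
have iD x y : iota (x + y) = iota x + iota y.
  by have := iZD 1 x y; rewrite rmorph1 !scale1r.
have i0 : iota 0 = 0 by apply: (addrI (iota 0)); rewrite -iD !addr0.
split.
- by move=> y a u v; apply: inj; rewrite iZD !brE iZD lieDl lieZl.
- by move=> x a u v; apply: inj; rewrite iZD !brE iZD lieDr lieZr.
- by move=> x; apply: inj; rewrite brE i0 liexx.
by move=> x y z; apply: inj; rewrite !iD !brE i0 lie_jacobi.
Qed.

Definition real_bracket (R : numFieldType) (n s : nat) (c : 'I_n -> 'I_n ->
  'rV[rat]_n)
    (P Q : 'M[R]_(n, s)) : 'M[R]_(n, s) :=
  \matrix_(l, k) \sum_i \sum_j ratr (c i j 0 l) * (P i k * Q j k).

Lemma anosov_of_weighted_basis (R : realType) (N : lieAlgType R) (n s : nat)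
    (c : 'I_n -> 'I_n -> 'rV[rat]_n) (w : 'I_n -> nat) (g : 'I_n -> 'I_s -> N) :
  (2 <= s)%N -> (forall l, 0 < w l)%N ->
  (forall i j l, c i j 0 l != 0 -> w l = (w i + w j)%N) ->
  bijective (fun P : 'M[R]_(n, s) => \sum_l \sum_k P l k *: g l k) ->
  (forall i j k k', lie (g i k) (g j k') =
     if k == k' then \sum_l ratr (c i j 0 l) *: g l k else 0) ->
  anosov N.
Proof.
move=> s2 w0 cw; set Phi := fun P => _ => Phi_bij lie_g.
have [C [th [Cu Vu CV th1]]] := unimodular_diagonalized R s2.
set V := Vandermonde _ _ in Vu CV.
have Phi_lin : linear Phi.
  move=> a P Q; rewrite /Phi scaler_sumr -big_split; apply: eq_bigr => l _ /=.
  rewrite scaler_sumr -big_split; apply: eq_bigr => k _ /=.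
  by rewrite !mxE scalerDl scalerA.
pose PhiL : {linear 'M[R]_(n, s) -> N} :=
  HB.pack Phi (GRing.isLinear.Build _ _ _ _ Phi Phi_lin).
have Phi_lie P Q : lie (Phi P) (Phi Q) = Phi (real_bracket c P Q).
  have lie_suml (I : finType) (F : I -> N) y : lie (\sum_i F i) y = \sum_i lie
    (F i) y.
    by rewrite (big_morph (@lie _ N ^~ y) (fun u v => lieDl u v y) (lie0l y)).
  have lie_sumr (I : finType) (F : I -> N) y : lie y (\sum_i F i) = \sum_i lie
    y (F i).
    by rewrite (big_morph (@lie _ N y) (fun u v => lieDr u v y) (lie0r y)).
  transitivity (\sum_k \sum_i \sum_j (P i k * Q j k) *:
      \sum_l ratr (c i j 0 l) *: g l k).
    rewrite /Phi lie_suml [RHS]exchange_big; apply: eq_bigr => i _ /=.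
    rewrite lie_suml; apply: eq_bigr => k _; rewrite lie_sumr.
    apply: eq_bigr => j _; rewrite lie_sumr (bigD1 k) //= lieZl lieZr lie_g eqxx.
    rewrite [X in _ + X]big1 ?addr0 ?scalerA // => k' /negPf k'k.
    by rewrite lieZl lieZr lie_g eq_sym k'k !scaler0.
  rewrite /Phi [RHS]exchange_big; apply: eq_bigr => k _ /=.
  under [RHS]eq_bigr => l _ do rewrite mxE scaler_suml.
  rewrite [RHS]exchange_big; apply: eq_bigr => i _ /=.
  under [RHS]eq_bigr => l _ do rewrite scaler_suml.
  rewrite [RHS]exchange_big; apply: eq_bigr => j _ /=.
  by rewrite scaler_sumr; apply: eq_bigr => l _; rewrite scalerA mulrC.
pose CQ : 'M[rat]_s := map_mx intr C.
pose CR : 'M[R]_s := map_mx intr C.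
have CQR : map_mx ratr CQ = CR by apply/matrixP => i j; rewrite !mxE ratr_int.
pose phi (X : 'M[rat]_(n, s)) : 'M[R]_(n, s) := map_mx ratr X *m V.
pose mulC (x y : 'rV[rat]_s) := \sum_m y 0 m *: (x *m CQ ^+ m).
have mulCV x y k : (map_mx ratr (mulC x y) *m V) 0 k
    = (map_mx ratr x *m V) 0 k * (map_mx ratr y *m V) 0 k.
  rewrite /mulC map_mx_sum mulmx_suml summxE [X in _ * X]mxE mulr_sumr.
  apply: eq_bigr => m _; rewrite map_mxZ map_mxM map_mxX CQR -scalemxAl.
  rewrite -mulmxA (intertwine_expr _ CV) expr_diag_mx mulmxA mxE.
  rewrite mul_mx_diag [X in _ * X]mxE; set a := (_ *m V) 0 k; clearbody a.
  by rewrite !mxE mulrCA.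
pose br (X Y : 'M[rat]_(n, s)) : 'M[rat]_(n, s) :=
  \matrix_l \sum_i \sum_j c i j 0 l *: mulC (row i X) (row j Y).
have phi_br X Y : phi (br X Y) = real_bracket c (phi X) (phi Y).
  apply/matrixP => l k; rewrite [RHS]mxE.
  transitivity ((row l (phi (br X Y))) 0 k); first by rewrite [RHS]mxE.
  rewrite /phi row_mul -map_row rowK map_mx_sum mulmx_suml summxE;
    apply: eq_bigr => i _.
  rewrite map_mx_sum mulmx_suml summxE; apply: eq_bigr => j _.
  rewrite map_mxZ -scalemxAl mxE mulCV !map_row -!row_mul.
  by rewrite [X in _ * (X * _)]mxE [X in _ * (_ * X)]mxE.
have phi_inj : injective phi.
  move=> X Y /(congr1 (mulmx^~ (invmx V))); rewrite /phi !mulmxK //.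
  exact: map_mx_inj.
pose iota X := Phi (phi X).
have iota_lin : linear_for (@ratr R \; *:%R) iota.
  move=> a X Y; rewrite /iota /phi map_mxD map_mxZ mulmxDl -scalemxAl.
  exact: Phi_lin.
have iota_inj : injective iota by move=> X Y /(bij_inj Phi_bij)/phi_inj.
have iota_br X Y : iota (br X Y) = lie (iota X) (iota Y).
  by rewrite /iota phi_br Phi_lie.
have [brl brr brxx br_jac] := semilinear_injective_lie iota_lin iota_inj iota_br.
pose M : lieAlgType rat :=
  HB.pack 'M[rat]_(n, s) (Vector_isLieAlgebra.Build rat 'M[rat]_(n, s) brl brr
    brxx br_jac).
have dimM : \dim (fullv : {vspace M}) = (n * s)%N by rewrite dimvf.
have dimN : \dim (fullv : {vspace N}) = (n * s)%N.
  by rewrite -(@bijective_dim _ _ _ PhiL Phi_bij) dimvf.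
exists M.
  pose iotaL : {linear M -> N | @ratr R \; *:%R} :=
    HB.pack (iota : M -> N) (GRing.isLinear.Build rat M N (@ratr R \;
      *:%R) iota iota_lin).
  exists iotaL; split=> [X Y|]; first exact: iota_br.
  rewrite basisEdim; apply/andP; split;
    last by rewrite size_map size_tuple dimM dimN.
  apply/subvP => y _; have [Psi _ PhiK] := Phi_bij.
  have iota_span X : iota X \in <<[seq iotaL b | b <- vbasis (fullv : {vspace
    M})]>>%VS.
    rewrite (coord_vbasis (memvf (X : M))) -[iota _]/(iotaL _) linear_sum
      rpred_sum // => i _.
    rewrite linearZ /= rpredZ // memv_span // (map_f iotaL) // mem_nth //.
    by rewrite size_tuple.
  rewrite -(PhiK y) -[Psi y](mulmxKV Vu).
  rewrite [_ *m invmx V]matrix_sum_delta mulmx_suml -[Phi _]/(PhiL _) linear_sum.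
  rewrite rpred_sum // => l _; rewrite mulmx_suml linear_sum rpred_sum // => k _.
  rewrite -scalemxAl linearZ rpredZ //=.
  have := iota_span (delta_mx l k); rewrite /iota /phi.
  by rewrite map_delta_mx.
pose Afun : {linear 'M[rat]_(n, s) -> 'M[rat]_(n, s)} := @weight_act _ n s w CQ.
have CQu : CQ \in unitmx by rewrite unitmxE det_map_mx rmorph_unit // -unitmxE.
pose A : 'End(M) := linfun (Afun : M -> M).
have AE X : A X = weight_act w CQ X by rewrite lfunE.
pose sg (P : 'M[R]_(n, s)) : 'M[R]_(n, s) := \matrix_(l, k) (P l k * th k ^+ w l).
have phiA X : phi (weight_act w CQ X) = sg (phi X).
  apply/row_matrixP => l; rewrite /phi row_mul map_weight_act row_weight_act CQR.
  rewrite -mulmxA (intertwine_expr _ CV) expr_diag_mx mulmxA -row_mul.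
  apply/rowP => k; rewrite mul_mx_diag mxE [X in X * _]mxE [X in _ * X]mxE.
  by rewrite [X in X ^+ _]mxE [RHS]mxE [RHS]mxE.
have sg_br P Q : real_bracket c (sg P) (sg Q) = sg (real_bracket c P Q).
  apply/matrixP => l k; rewrite [LHS]mxE [RHS]mxE [X in X * _]mxE mulr_suml.
  apply: eq_bigr => i _; rewrite mulr_suml; apply: eq_bigr => j _.
  have [->|/cw ->] := eqVneq (c i j 0 l) 0; first by rewrite rmorph0 !mul0r.
  by rewrite [sg P i k]mxE [sg Q j k]mxE exprD; ring.
have A_aut : lie_automorphism A.
  split; first exists (weight_act w (invmx CQ) : M -> M).
  - by move=> X; rewrite AE weight_actK.
  - move=> X; rewrite AE -{1}(invmxK CQ) weight_actK // unitmx_inv //.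
  move=> X Y; apply: iota_inj; rewrite !AE [lie _ _ in RHS]/(br _ _).
  rewrite -[lie X Y]/(br X Y) /iota phiA phi_br -sg_br -!phiA -phi_br //.
pose mv : {linear M -> 'rV[rat]_(n * s)} := @mxvec _ n s.
have mv_bij : bijective mv by exists vec_mx; [exact: mxvecK | exact: vec_mxK].
have mvA v : mv (A v) = mv v *m map_mx intr (lin_mx (@weight_act _ n s w C)).
  rewrite AE (map_lin_mx (gf := weight_act w CQ)); last exact: map_weight_act.
  by rewrite /mv /= mul_vec_lin.
have [A_uni A_hyp] := unimodular_hyperbolic mv_bij (lin_weight_act_unit w Cu) mvA
  (weight_act_eigenvalue w0 Vu CV th1).
by exists A.
Qed.

(** * Weighted bases *)

Lemma basis_crd (K : fieldType) (V : vectType K) (T : finType) (b : T -> V) :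
  basis_of fullv (codom b) ->
  exists crd : V -> T -> K, (forall v, v = \sum_t crd v t *: b t) /\
    forall a t, crd (\sum_u a u *: b u) t = a t.
Proof.
move=> bb; pose X := codom_tuple b.
have XE (t : T) : X`_(enum_rank t) = b t by rewrite nth_codom enum_rankK.
have sumE (a : T -> K) : \sum_t a t *: b t = \sum_(i < #|T|) a (enum_val i) *: X`_i.
  rewrite (reindex (@enum_rank T)) /=; last first.
    by exists enum_val => ? _; rewrite (enum_rankK, enum_valK).
  by apply: eq_bigr => t _; rewrite XE enum_rankK.
exists (fun v t => coord X (enum_rank t) v); split=> [v|a t].
  rewrite sumE {1}(coord_basis (X := X) bb (memvf v)).
  by apply: eq_bigr => i _; rewrite enum_valK.
by rewrite sumE coord_sum_free ?enum_rankK // (basis_free (X := X) bb).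
Qed.

Lemma semilinear_basis (R : realType) (L : vectType rat) (N : vectType R)
    (iota : {linear L -> N | @ratr R \; *:%R}) (X Y : seq L) :
  basis_of fullv X -> basis_of fullv Y ->
  basis_of fullv (map iota X) -> basis_of fullv (map iota Y).
Proof.
move=> bX bY; rewrite !basisEdim => /andP[/subvP sX dX].
have sizeXY : size X = size Y 
    by rewrite -(size_basis (X := in_tuple X) bX) (size_basis (X := in_tuple Y) bY).
rewrite size_map -sizeXY; rewrite size_map in dX; rewrite dX andbT.
apply: (subv_trans (introT subvP sX)); apply/span_subvP => _ /mapP[x xX ->].
have : x \in <<in_tuple Y>>%VS by rewrite (span_basis bY) memvf.
move/coord_span->; rewrite linear_sum rpred_sum // => i _.
by rewrite linearZ /= rpredZ // memv_span // map_f // mem_nth.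
Qed.

Definition single (K : fieldType) (I : finType) (V : vectType K) (k : I) (v : V) :
  {ffun I -> V} := [ffun k' => if k' == k then v else 0].

Lemma single_basis (K : fieldType) (I T : finType) (V : vectType K) (b : T -> V) :
  basis_of fullv (codom b) ->
  basis_of fullv (codom (fun p : T * I => single p.2 (b p.1))).
Proof.
move=> bb; rewrite basisEdim size_map -cardE card_prod; apply/andP; split.
  apply/subvP => f _.
  have -> : f = \sum_k single k (f k).
    apply/ffunP => k; rewrite sum_ffunE (bigD1 k) //= ffunE eqxx big1 ?addr0 //.
    by move=> k' k'k; rewrite ffunE eq_sym (negPf k'k).
  apply: rpred_sum => k _.
  have : f k \in <<codom b>>%VS by rewrite (span_basis bb) memvf.
  rewrite -[codom b]/(val (in_tuple (codom b))) => /coord_span->.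
  set c := coord _; have -> : single k (\sum_i c i (f k) *: (in_tuple (codom b))`_i)
     = \sum_i c i (f k) *: single k (in_tuple (codom b))`_i.
    apply/ffunP => k'; rewrite sum_ffunE ffunE; case: eqP => [kk|/eqP kk].
      by apply: eq_bigr => i _; rewrite !ffunE kk eqxx.
    by rewrite big1 // => i _; rewrite !ffunE (negPf kk) scaler0.
  apply: rpred_sum => i _; rewrite rpredZ // memv_span //.
  have /codomP[t ->] : (in_tuple (codom b))`_i \in codom b by rewrite mem_nth.
  by apply/codomP; exists (t, k).
have := size_basis (X := in_tuple (codom b)) bb; rewrite size_map -cardE => <-.
by rewrite !dimvf /dim /= mulnC leqnn.
Qed.

Definition weighted (K : fieldType) (L : lieAlgType K) : Prop :=
  exists (n : nat) (b : 'I_n -> L) (w : 'I_n -> nat),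
    [/\ basis_of fullv (codom b), forall i, (0 < w i)%N &
      forall i j, exists c : 'rV[K]_n, lie (b i) (b j) = \sum_l c 0 l *: b l /\
        forall l, c 0 l != 0 -> w l = (w i + w j)%N].

Lemma graded_weighted (K : fieldType) (L : lieAlgType K) :
  graded L -> weighted L.
Proof.
case=> k [V [Vfull Vdir V0 Vlie]].
pose T : finType := {i : 'I_k & 'I_(\dim (V i.+1))}%type.
pose b (t : T) : L := (vbasis (V (tag t).+1))`_(tagged t).
pose w (t : T) := (tag t).+1.
have bV t : b t \in V (w t) by rewrite vbasis_mem // mem_nth // size_tuple.
have dimT : #|T| = \dim (fullv : {vspace L}).
  rewrite card_tagged sumnE big_map big_enum /= -Vfull (directvP Vdir) /=.
  by apply: eq_bigr => i _; rewrite card_ord.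
have exp_V m x : (0 < m)%N -> x \in V m ->
    exists2 c : T -> K, x = \sum_t c t *: b t & forall t, c t != 0 -> w t = m.
  case: m => // m _ xV; have [lt_mk|le_km] := ltnP m k; last first.
    exists (fun=> 0) => [|t]; last by rewrite eqxx.
    move: xV; rewrite V0 // memv0 => /eqP->.
    by rewrite big1 // => t _; rewrite scale0r.
  pose i := Ordinal lt_mk.
  exists (fun t => if tag t == i then coord (vbasis (V (tag t).+1)) (tagged t)
    x else 0).
    transitivity (\sum_(t : T | (tag t == i) && true)
        coord (vbasis (V (tag t).+1)) (tagged t) x *: b t).
      rewrite -(sig_big_dep (fun i' => i' == i) (fun _ _ => true)
        (fun i' j => coord (vbasis (V i'.+1)) j x *: (vbasis (V i'.+1))`_j)).
      by rewrite big_pred1_eq -coord_vbasis.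
    rewrite big_mkcond; apply: eq_bigr => t _; rewrite andbT.
    by case: ifP => // _; rewrite scale0r.
  by move=> t; have [ti _|_] := eqVneq (tag t) i; [rewrite /w ti | rewrite eqxx].
have reidx (F : T -> L) : \sum_t F t = \sum_(i < #|T|) F (enum_val i).
  by rewrite (reindex (@enum_val T T)) //=; exact: (onW_bij _ (@enum_val_bij T)).
exists #|T|, (b \o enum_val), (w \o enum_val); split=> [|i|i j] //.
  rewrite basisEdim; apply/andP; split;
    last by rewrite size_map -cardE card_ord dimT.
  rewrite -Vfull.
  apply/subv_sumP => i _; rewrite -{1}(span_basis (vbasisP (V i.+1))).
  apply/span_subvP => x xB; apply: memv_span.
  have ltx : (index x (vbasis (V i.+1)) < \dim (V i.+1))%N.
    by rewrite -[X in (_ < X)%N](size_tuple (vbasis (V i.+1))) index_mem.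
  pose t : T := Tagged (fun i : 'I_k => 'I_(\dim (V i.+1))) (Ordinal ltx).
  apply/codomP; exists (enum_rank t); rewrite /= enum_rankK.
  by rewrite /b /= nth_index.
have wp t : (0 < w t)%N by [].
have [c -> cw] := exp_V (w (enum_val i) + w (enum_val j))%N
  (lie (b (enum_val i)) (b (enum_val j))) isT
  (Vlie _ _ _ _ (wp _) (wp _) (bV _) (bV _)).
exists (\row_l c (enum_val l)); split=> [|l]; last by rewrite mxE => /cw.
by rewrite reidx; apply: eq_bigr => l _; rewrite mxE.
Qed.

Lemma rational_form_ffun (R : realType) (I : finType) (L : lieAlgType rat)
    (N : lieAlgType R) :
  rational_form L N -> rational_form {ffun I -> L} {ffun I -> N}.
Proof.
case=> iota [iota_lie iota_basis].
pose ff (f : {ffun I -> L}) : {ffun I -> N} := [ffun k => iota (f k)].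
have ff_lin : linear_for (@ratr R \; *:%R) ff.
  by move=> a f h; apply/ffunP => k; rewrite !ffunE linearP.
pose ffL : {linear {ffun I -> L} -> {ffun I -> N} | @ratr R \; *:%R} :=
  HB.pack ff (GRing.isLinear.Build rat _ _ (@ratr R \; *:%R) ff ff_lin).
exists ffL; split=> [f h|]; first by apply/ffunP => k; rewrite !ffunE iota_lie.
pose X : (\dim (fullv : {vspace L})).-tuple L := vbasis fullv.
have XE : codom (tnth X) = X by rewrite codomE map_tnth_enum.
have bX : basis_of fullv (codom (tnth X)) by rewrite XE vbasisP.
have biX : basis_of fullv (codom (fun t => iota (tnth X t))).
  by rewrite codomE map_comp -codomE XE.
apply: semilinear_basis (single_basis I bX) (vbasisP _) _.
have := single_basis I biX; congr (is_true (basis_of _ _)).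
rewrite /codom /image_mem -[RHS]map_comp; apply: eq_map => p /=.
by apply/ffunP => k; rewrite !ffunE; case: ifP; rewrite ?linear0.
Qed.

Lemma single_lie (K : fieldType) (I : finType) (L : lieAlgType K) (k k' : I)
    (x y : L) :
  lie (single k x) (single k' y) = if k == k' then single k (lie x y) else 0.
Proof.
apply/ffunP => i; rewrite [LHS]ffunE !ffunE.
have [<-|kk'] := eqVneq k k'.
  by rewrite ffunE; case: ifP; rewrite ?lie0l.
rewrite ffunE; have [->|_] := eqVneq i k; last by rewrite lie0l.
by rewrite (negPf kk') lie0r.
Qed.

Lemma weighted_anosov (R : realType) (s : nat) (L : lieAlgType rat)
    (N : lieAlgType R) :
  (2 <= s)%N -> weighted L -> rational_form {ffun 'I_s -> L} N -> anosov N.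
Proof.
move=> s2 [n [b [w [bb w0 bw]]]] [iota [iota_lie iota_basis]].
have exc p : exists c : 'rV[rat]_n, (lie (b p.1) (b p.2) == \sum_l c 0 l *: b l)
    && [forall l, (c 0 l != 0) ==> (w l == (w p.1 + w p.2)%N)].
  have [c [E cw]] := bw p.1 p.2; exists c; rewrite E eqxx.
  by apply/forallP => l; apply/implyP => /cw ->.
pose c i j := xchoose (exc (i, j)).
have cP i j := andP (xchooseP (exc (i, j))).
pose g l k := iota (single k (b l)).
have bg : basis_of fullv (codom (fun p : 'I_n * 'I_s => g p.1 p.2)).
  have := semilinear_basis (vbasisP _) (single_basis 'I_s bb) iota_basis.
  by rewrite -map_comp.
have [crd [crdE crdK]] := basis_crd bg.
have sumE (P : 'M[R]_(n, s)) :
    \sum_l \sum_k P l k *: g l k = \sum_p P p.1 p.2 *: g p.1 p.2.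
  by rewrite pair_bigA.
apply: (@anosov_of_weighted_basis _ _ n s c w g) => //.
- by move=> i j l; have [_ /forallP/(_ l)/implyP H] := cP i j => /H/eqP.
- exists (fun v => \matrix_(l, k) crd v (l, k)) => [P|v].
    by apply/matrixP => l k; rewrite mxE sumE (crdK (fun p => P p.1 p.2)).
  rewrite sumE [RHS](crdE v); apply: eq_bigr => -[l k] _.
  by rewrite mxE.
move=> i j k k'; rewrite /g -iota_lie single_lie; case: ifP => _;
  last exact: linear0.
have [/eqP E _] := cP i j; rewrite {}E -/(c i j).
have -> : single k (\sum_l c i j 0 l *: b l) = \sum_l c i j 0 l *: single k (b l).
  apply/ffunP => m; rewrite sum_ffunE ffunE; case: ifP => mk.
    by apply: eq_bigr => l _; rewrite !ffunE mk.
  by rewrite big1 // => l _; rewrite !ffunE mk scaler0.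
by rewrite linear_sum; apply: eq_bigr => l _; rewrite linearZ.
Qed.

Definition structure_mx (K : comNzRingType) (n : nat) (c : 'I_n -> 'I_n ->
  'rV[K]_n) :
    'M[K]_(n * n, n) :=
  \sum_i \sum_j (delta_mx (mxvec_index i j) 0 : 'cV_(n * n)) *m c i j.

Lemma mul_structure_mx (K : comNzRingType) (n : nat)
    (c : 'I_n -> 'I_n -> 'rV[K]_n) (X : 'M[K]_n) :
  mxvec X *m structure_mx c = \sum_i \sum_j X i j *: c i j.
Proof.
rewrite mulmx_sumr; apply: eq_bigr => i _; rewrite mulmx_sumr;
  apply: eq_bigr => j _.
by rewrite mulmxA -colE [col _ _]mx11_scalar mul_scalar_mx mxE mxvecE.
Qed.

Lemma map_structure_mx (K K' : comNzRingType) (f : {rmorphism K -> K'}) (n : nat)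
    (c : 'I_n -> 'I_n -> 'rV[K]_n) :
  map_mx f (structure_mx c) = structure_mx (fun i j => map_mx f (c i j)).
Proof.
rewrite map_mx_sum; apply: eq_bigr => i _; rewrite map_mx_sum;
  apply: eq_bigr => j _.
by rewrite map_mxM map_delta_mx.
Qed.

Definition lcomb (K : fieldType) (V : vectType K) (n : nat) (b : 'I_n -> V)
  (x : 'rV[K]_n) : V := \sum_i x 0 i *: b i.

Lemma lcomb_delta (K : fieldType) (V : vectType K) (n : nat) (b : 'I_n -> V)
    (i : 'I_n) : lcomb b (delta_mx 0 i) = b i.
Proof.
rewrite /lcomb (bigD1 i) //= mxE !eqxx scale1r big1 ?addr0 // => j /negPf ji.
by rewrite mxE ji andbF scale0r.
Qed.

Lemma lie_lcomb (K : fieldType) (L : lieAlgType K) (n : nat) (b : 'I_n -> L)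
    (c : 'I_n -> 'I_n -> 'rV[K]_n) (x y : 'rV[K]_n) :
  (forall i j, lie (b i) (b j) = lcomb b (c i j)) ->
  lie (lcomb b x) (lcomb b y) = lcomb b (mxvec (x^T *m y) *m structure_mx c).
Proof.
move=> cE; rewrite mul_structure_mx /lcomb.
rewrite (big_morph (@lie _ L ^~ _) (fun u v => lieDl u v _) (lie0l _)).
under [RHS]eq_bigr => l _ do rewrite summxE scaler_suml.
rewrite [RHS]exchange_big; apply: eq_bigr => i _ /=.
rewrite (big_morph (@lie _ L _) (fun u v => lieDr u v _) (lie0r _)).
under [RHS]eq_bigr => l _ do rewrite summxE scaler_suml.
rewrite [RHS]exchange_big; apply: eq_bigr => j _ /=.
rewrite lieZl lieZr cE /lcomb !scaler_sumr; apply: eq_bigr => l _.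
by rewrite !scalerA !mxE big_ord1 !mxE.
Qed.

Lemma mx_derivation_eigenbasis (K : fieldType) (n : nat) (mu : 'M[K]_(n * n, n))
    (P : 'M[K]_n) (w : 'rV[K]_n) : P \in unitmx ->
  mx_derivation mu (invmx P *m diag_mx w *m P) <->
  forall i j, let z := mxvec ((row i P)^T *m row j P) *m mu in
    z *m (invmx P *m diag_mx w *m P) = (w 0 i + w 0 j) *: z.
Proof.
move=> Pu; set D := _ *m P.
have PD i : row i P *m D = w 0 i *: row i P.
  by rewrite /D !mulmxA -row_mul mulmxV // row1 -rowE row_diag_mx -scalemxAl -rowE.
have DP i : D^T *m (row i P)^T = w 0 i *: (row i P)^T.
  by rewrite -trmx_mul PD linearZ.
have E i j : D^T *m ((row i P)^T *m row j P) + (row i P)^T *m row j P *m D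
    = (w 0 i + w 0 j) *: ((row i P)^T *m row j P).
  by rewrite mulmxA DP -mulmxA PD -scalemxAl -scalemxAr scalerDl.
split=> [/mx_derivationP dD i j /=|eD].
  by rewrite -dD E linearZ /= scalemxAl.
apply/mx_derivationP => X; pose Y := invmx P^T *m X *m invmx P.
have -> : X = \sum_i \sum_j Y i j *: ((row i P)^T *m row j P).
  have {1}-> : X = P^T *m Y *m P.
    by rewrite /Y !mulmxA mulmxV ?unitmx_tr // mul1mx mulmxKV.
  rewrite [Y in LHS]matrix_sum_delta mulmx_sumr mulmx_suml; apply: eq_bigr => i _.
  rewrite mulmx_sumr mulmx_suml; apply: eq_bigr => j _.
  rewrite -scalemxAr -scalemxAl -(mul_delta_mx (0 : 'I_1)); congr (_ *: _).
  by rewrite !mulmxA -colE -mulmxA -rowE tr_row.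
rewrite mulmx_sumr mulmx_suml -big_split !linear_sum !mulmx_suml.
apply: eq_bigr => i _;
  rewrite mulmx_sumr mulmx_suml -big_split !linear_sum !mulmx_suml.
apply: eq_bigr => j _ /=.
rewrite -scalemxAr -scalemxAl -scalerDr E !linearZ /= -!scalemxAl eD.
by rewrite !scalemxAl.
Qed.

Lemma row_crd (K : fieldType) (V : vectType K) (n : nat) (b : 'I_n -> V) :
  basis_of fullv (codom b) ->
  exists2 crd : V -> 'rV[K]_n, cancel crd (lcomb b) & cancel (lcomb b) crd.
Proof.
move=> /basis_crd[crd [crdE crdK]].
exists (fun v => \row_i crd v i) => [v|x].
  by rewrite [RHS]crdE; apply: eq_bigr => i _; rewrite mxE.
by apply/rowP => i; rewrite mxE crdK.
Qed.

Lemma lcomb_mul (K : fieldType) (V : vectType K) (m n : nat) (b : 'I_n -> V)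
    (P : 'M[K]_(m, n)) (x : 'rV[K]_m) :
  lcomb (fun i => lcomb b (row i P)) x = lcomb b (x *m P).
Proof.
rewrite /lcomb; under [RHS]eq_bigr => j _ do rewrite mxE scaler_suml.
rewrite [RHS]exchange_big; apply: eq_bigr => i _.
by rewrite scaler_sumr; apply: eq_bigr => j _; rewrite scalerA mxE.
Qed.

Lemma weighted_descent (R : realType) (L : lieAlgType rat) (N : lieAlgType R) :
  rational_form L N -> weighted N -> weighted L.
Proof.
case=> iota [iota_lie iota_basis] [n [g [w [bg w0 gw]]]].
pose X : (\dim (fullv : {vspace L})).-tuple L := vbasis fullv.
have XE : codom (tnth X) = X by rewrite codomE map_tnth_enum.
have dimL : \dim (fullv : {vspace L}) = n.
  have := size_basis (X := in_tuple _) iota_basis;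
    rewrite size_map size_tuple => <-.
  have := size_basis (X := in_tuple _) bg; rewrite size_map -cardE card_ord.
  by [].
have [b bb bib] : exists2 b : 'I_n -> L, basis_of fullv (codom b) &
    basis_of fullv (codom (iota \o b)).
  rewrite -dimL; exists (tnth X); first by rewrite XE vbasisP.
  by rewrite codomE map_comp -codomE XE.
move: {X XE dimL} n g w bg w0 gw b bb bib => [|n] g w bg w0 gw b bb bib.
  by exists 0%N, b, (fun=> 1%N); split=> // -[].
have [crd crdK lcombK] := row_crd bb; have [crdN crdNK lcombNK] := row_crd bib.
pose c i j := crd (lie (b i) (b j)).
have cE i j : lie (b i) (b j) = lcomb b (c i j) by rewrite crdK.
pose cN i j : 'rV[R]_n.+1 := map_mx ratr (c i j).
have cNE i j : lie ((iota \o b) i) ((iota \o b) j) = lcomb (iota \o b) (cN i j).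
  rewrite /= -iota_lie cE linear_sum; apply: eq_bigr => l _.
  by rewrite linearZ /= mxE.
pose P : 'M[R]_n.+1 := \matrix_i crdN (g i).
have gP i : g i = lcomb (iota \o b) (row i P) by rewrite rowK crdNK.
have [crdg crdgK lcombgK] := row_crd bg.
have gE x : lcomb g x = lcomb (iota \o b) (x *m P).
  by rewrite -lcomb_mul; apply: eq_bigr => i _; rewrite -gP.
have lcombN_inj := can_inj lcombNK.
have Pu : P \in unitmx.
  have P'P : (\matrix_i crdg (iota (b i))) *m P = 1%:M.
    apply/row_matrixP => i; rewrite row_mul row1; apply: lcombN_inj.
    by rewrite -gE rowK crdgK lcomb_delta.
  by have [] := mulmx1_unit P'P.
pose mu := structure_mx c.
have muR : map_mx ratr mu = structure_mx cN by exact: map_structure_mx.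
have dP : mx_derivation (map_mx ratr mu)
    (invmx P *m diag_mx (\row_i (w i)%:R) *m P).
  apply/mx_derivation_eigenbasis => // i j /=; rewrite muR; set z := mxvec _ *m _.
  have [a [ga aw]] := gw i j.
  have -> : z = a *m P.
    by apply: lcombN_inj; rewrite -gE /z -(lie_lcomb _ _ cNE) -!gP.
  rewrite !mulmxA mulmxK // scalemxAl; congr (_ *m P).
  apply/rowP => l; rewrite mul_mx_diag !mxE -natrD mulrC.
  by have [->|/aw ->//] := eqVneq (a 0 l) 0; rewrite !mulr0.
have [Q [w' [Qu w'0 dQ]]] := graded_descent Pu w0 dP.
exists n.+1, (fun i => lcomb b (row i Q)), w'; split=> // [|i j].
  rewrite basisEdim size_map -cardE card_ord; apply/andP; split; last first.
    have := size_basis (X := in_tuple _) bb; rewrite size_map -cardE card_ord.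
    by move=> ->.
  apply/subvP => v _; rewrite -[v]crdK -[crd v](mulmxKV Qu) -lcomb_mul.
  by apply: rpred_sum => i _; rewrite rpredZ // memv_span // codom_f.
pose z := mxvec ((row i Q)^T *m row j Q) *m mu.
exists (z *m invmx Q); split=> [|l].
  by rewrite -/(lcomb _ _) lcomb_mul mulmxKV // -lie_lcomb.
have /mx_derivation_eigenbasis := dQ => /(_ Qu i j) /=; rewrite -/z => zD.
have := congr1 (mulmx^~ (invmx Q)) zD; rewrite !mulmxA mulmxK // -scalemxAl.
move/rowP/(_ l); rewrite mul_mx_diag [LHS]mxE [RHS]mxE [RHS]mulrC => E c0.
by move/(mulfI c0)/eqP: E; rewrite !mxE -natrD eqr_nat => /eqP.
Qed.

Theorem theorem3p7 (R : realType) (s : nat) (hs : (2 <= s)%N) :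
  (forall L : lieAlgType rat,
     graded L -> anosov (real_ext R {ffun 'I_s -> L})) /\
  (forall N : lieAlgType R,
     graded N -> (exists L : lieAlgType rat, rational_form L N) ->
     anosov {ffun 'I_s -> N}).
Proof.
split=> [L /graded_weighted wL|N /graded_weighted wN [L LN]].
  exact: weighted_anosov hs wL (real_ext_rational_form R _).
exact: weighted_anosov hs (weighted_descent LN wN) (rational_form_ffun _ LN).
Qed.
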